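(* Let $\mathfrak c$ be any chamber of the projective sequence $\mathfrak A$ in $\Gamma^*_{\mathfrak a}$, and let $\xi\in\mathfrak c$ be a vector which is regular with respect to $\Sigma\mathfrak A$. Then for every $\phi\in\mathbb C_{\mathfrak A}[\mathfrak a]$ $$\mathrm{JK}_{\mathfrak c}(\phi)=\sum_{F\in\mathcal{FL}^+(\mathfrak A,\xi)}\nu(F)\,\mathrm{Res}_F\,\phi .$$
   Context: Setting. $\mathfrak a$ is an oriented real vector space of dimension $r$ with a full rank lattice $\Gamma_{\mathfrak a}$, $\Gamma^*_{\mathfrak a}\subset\mathfrak a^*$ is the dual lattice, and $\mathfrak A=[\alpha_1,\dots,\alpha_n]$ is a sequence of elements of $\Gamma_{\mathfrak a}^*$ (repetitions allowed) generating $\Gamma_{\mathfrak a}^*$ over $\mathbb Z$. It is projective if it lies in an open (linear) half space of $\mathfrak a^*$. $d\mu$ is the translation invariant volume form on $\mathfrak a$ (extended holomorphically to $\mathfrak a_{\mathbb C}$) determined by the orientation and $\Gamma_{\mathfrak a}$ (signed unit volume on a fundamental parallelepiped). $\mathfrak a^*$ carries the dual orientation. Chambers. For an index set $\sigma$ such that $\boldsymbol\gamma^\sigma=(\alpha_i)_{i\in\sigma}$ is a basis of $\mathfrak a^*$, let $\mathrm{Cone}(\boldsymbol\gamma^\sigma)$ be the closed cone it spans. Chambers are the connected components of the closed cone $\mathrm{Cone}(\mathfrak A)$ minus the union of the boundaries of all the cones $\mathrm{Cone}(\boldsymbol\gamma^\sigma)$. Jeffrey–Kirwan residue. $\mathbb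 C_{\mathfrak A}[\mathfrak a]$ is the space of rational functions on $\mathfrak a_{\mathbb C}$ whose denominators are products of powers of elements of $\mathfrak A$. $\mathrm{JK}_{\mathfrak c}$ is the (well defined) linear functional on $\mathbb C_{\mathfrak A}[\mathfrak a]$ such that $\mathrm{JK}_{\mathfrak c}(1/\prod_{i\in\sigma}\alpha_i)$ equals $|\mathrm{vol}(\boldsymbol\gamma^\sigma)|^{-1}$ if $\mathfrak c\subset\mathrm{Cone}(\boldsymbol\gamma^\sigma)$ and $0$ if $\mathfrak c\cap\mathrm{Cone}(\boldsymbol\gamma^\sigma)=\emptyset$ (volume of the parallelepiped spanned by $\boldsymbol\gamma^\sigma$ in units of $\Gamma_{\mathfrak a}^*$), and which vanishes on functions of homogeneous degree $\ne -r$ and on fractions whose denominator consists of linear forms not spanning $\mathfrak a^*$. Flags and iterated residues. $\mathcal{FL}(\mathfrak A)$ is the finite set of flags $F=[\{0\}=F_0\subset F_1\subset\dots\subset F_r=\mathfrak a^*]$, $\dim F_j=j$, such that $\mathfrak A$ contains a basis of each $F_j$. For each $F$ fix a basis $(\gamma_1^F,\dots,\gamma_r^F)$ of $\mathfrak a^*$, with $\gamma^F_j\in\Gamma^*_{\mathfrak a}\otimes\mathbb Q$, positively oriented, such that $\gamma_1^F,\dots,\gamma_j^F$ is a basis of $F_j$ for each $j$ and $d\gamma_1^F\wedge\dots\wedge d\gamma_r^F=d\mu$. Using the coordinates $u_j=\gamma_j^F(u)$ and writing $\phi(u)=\phi^F(u_1,\dots,u_r)$, set $$\mathrm{Res}_F\,\phi=\mathrm{Res}_{u_r=0}du_r\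 \mathrm{Res}_{u_{r-1}=0}du_{r-1}\cdots\mathrm{Res}_{u_1=0}du_1\ \phi^F(u_1,\dots,u_r),$$ each residue being taken with the variables of higher index fixed at nonzero values (so the $u_1$ residue is taken first). It does not depend on the choice of the basis. Regularity. $\Sigma\mathfrak A=\{\sum_{i\in\eta}\alpha_i:\eta\subset\{1,\dots,n\}\}$. $\xi$ is regular with respect to $\Sigma\mathfrak A$ if for every basis $\boldsymbol\rho\subset\Sigma\mathfrak A$ of $\mathfrak a^*$ all coordinates of $\xi$ in the basis $\boldsymbol\rho$ are nonzero. Signs and $\mathcal{FL}^+$. For $F\in\mathcal{FL}(\mathfrak A)$ let $\kappa_j^F=\sum\{\alpha_i: 1\le i\le n,\ \alpha_i\in F_j\}$, $j=1,\dots,r$. $F$ is proper if $\kappa_1^F,\dots,\kappa_r^F$ are linearly independent. $\nu(F)=0$ if $F$ is not proper; otherwise $\nu(F)=1$ or $-1$ according to whether $(\kappa_1^F,\dots,\kappa_r^F)$ is a positively or negatively oriented basis of $\mathfrak a^*$. $\mathcal{FL}^+(\mathfrak A,\xi)$ is the set of flags $F\in\mathcal{FL}(\mathfrak A)$ such that $\xi\in\mathfrak s^+(F,\mathfrak A):=\sum_{j=1}^r\mathbb R^{\ge0}\kappa_j^F$ (for regular $\xi$ all such flags are proper). *)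

(* Defs.v *)
From HB Require Import structures.
From mathcomp Require Export all_boot all_order all_algebra.
From mathcomp Require Export fraction complex.
(* The notations of mpoly clash with those of mathcomp-analysis. *)
From mathcomp Require Export -(notations) mpoly.
From mathcomp Require Export boolp classical_sets functions fsbigop.
From mathcomp Require Export reals topology normedtype.

Set Implicit Arguments.
Unset Strict Implicit.
Unset Printing Implicit Defensive.

Export Order.TTheory GRing.Theory Num.Theory.
Export numFieldNormedType.Exports.

Open Scope classical_set_scope.
Open Scope ring_scope.

Local Notation "x %:F" := (tofrac x).

(* Conventions.
   The space a is 'cV[R]_r and its dual a^* is 'rV[R]_r, with pairing
   alpha *m v.  The columns of an invertible matrix B form a positively
   oriented Z-basis of the lattice Gamma_a; thus B carries both the lattice and
   the orientation of a.  For a square matrix M whose rows are elements of a^*,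
   M *m B is the matrix of M in the basis of a^* dual to B, which is a
   positively oriented Z-basis of the dual lattice. *)

Section Lattice.
Variables (R : realType) (r : nat).
Implicit Types (B M : 'M[R]_r) (a : 'rV[R]_r).

Definition dual_lattice B : set 'rV[R]_r :=
  [set a | forall j, (a *m B) 0 j \is a Num.int].

Definition dual_lattice_rat B : set 'rV[R]_r :=
  [set a | exists2 N : nat, (0 < N)%N & dual_lattice B (a *+ N)].

Definition positively_oriented B M : Prop := 0 < \det (M *m B).

(* The value of dmu on r vectors of a, given as the columns of V; it is 1 on
   the columns of B. *)
Definition dmu B (V : 'M[R]_r) : R := \det (invmx B *m V).

(* The wedge product of the linear forms given by the rows of M, evaluated on
   the columns of V. *)
Definition wedge M (V : 'M[R]_r) : R := \det (M *m V).

(* The volume of the parallelepiped spanned by the first r elements of s, the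
   fundamental parallelepipeds of the dual lattice having volume 1. *)
Definition vol B (s : seq 'rV[R]_r) : R :=
  `|\det ((\matrix_(j < r) nth 0 s j) *m B)|.

End Lattice.

Section Arrangement.
Variables (R : realType) (r n : nat) (alpha : 'I_n -> 'rV[R]_r).
Implicit Types (sigma : {set 'I_n}).

Definition generates_dual_lattice (B : 'M[R]_r) : Prop :=
  forall b, dual_lattice B b ->
    exists m : 'I_n -> int, b = \sum_i alpha i *~ m i.

Definition projective : Prop :=
  exists v : 'cV[R]_r, forall i, 0 < (alpha i *m v) 0 0.

Definition gamma_seq sigma : seq 'rV[R]_r := [seq alpha i | i <- enum sigma].

Definition index_basis sigma : Prop :=
  basis_of {:'rV[R]_r}%VS (gamma_seq sigma).

Definition cone sigma : set 'rV[R]_r :=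
  [set v | exists2 t : 'I_n -> R, (forall i, 0 <= t i)
     & v = \sum_(i in sigma) t i *: alpha i].

Definition boundary (A : set 'rV[R]_r) : set 'rV[R]_r :=
  closure A `\` interior A.

Definition chamber_locus : set 'rV[R]_r :=
  cone [set: 'I_n]%SET
    `\` \bigcup_(sigma in [set s | index_basis s]) boundary (cone sigma).

Definition chamber (c : set 'rV[R]_r) : Prop :=
  exists2 x, chamber_locus x & c = connected_component chamber_locus x.

Definition partial_sums : set 'rV[R]_r :=
  [set v | exists eta : {set 'I_n}, v = \sum_(i in eta) alpha i].

Definition regular (xi : 'rV[R]_r) : Prop :=
  forall rho : r.-tuple 'rV[R]_r,
    (forall v, v \in (rho : seq _) -> partial_sums v) ->
    basis_of {:'rV[R]_r}%VS rho ->
    forall j, coord rho j xi != 0.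

End Arrangement.

Section RationalFunctions.
Variables (R : realType) (r : nat).

Notation ratfun := {fraction (mpoly r R[i])}.

Definition linear_form (a : 'rV[R]_r) : mpoly r R[i] :=
  \sum_(j < r) (real_complex R (a 0 j)) *: mpolyX R[i] (mnm1 j).

Definition den n (alpha : 'I_n -> 'rV[R]_r) (k : 'I_n -> nat) : mpoly r R[i] :=
  \prod_i linear_form (alpha i) ^+ k i.

(* The space C_A[a]. *)
Definition CA n (alpha : 'I_n -> 'rV[R]_r) : set ratfun :=
  [set phi | exists p k, phi = p%:F / (den alpha k)%:F].

Definition homogeneous_poly (d : nat) (p : mpoly r R[i]) : Prop :=
  p \is ishomog1 d mdeg.

Definition homogeneous_ratfun (d : int) (phi : ratfun) : Prop :=
  exists d1 d2 p q, [/\ homogeneous_poly d1 p, homogeneous_poly d2 q, q != 0,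
    phi = p%:F / q%:F & d = d1%:Z - d2%:Z].

(* The value of phi at a point where phi is regular; 0 at the other points. *)
Definition rf_eval (phi : ratfun) (v : 'cV[R[i]]_r) : R[i] :=
  xget 0 [set y | exists p q : mpoly r R[i],
    [/\ phi = p%:F / q%:F, meval (fun j => v j 0) q != 0
      & y = meval (fun j => v j 0) p / meval (fun j => v j 0) q]].

Section JeffreyKirwan.
Variables (n : nat) (B : 'M[R]_r) (alpha : 'I_n -> 'rV[R]_r).
Variable (c : set 'rV[R]_r).

Record is_JK (L : ratfun -> R[i]) : Prop := {
  JK_linear : forall (a : R[i]) (phi psi : ratfun),
    CA alpha phi -> CA alpha psi ->
    L ((mpolyC r a)%:F * phi + psi) = a * L phi + L psi;
  JK_inside : forall sigma : {set 'I_n}, index_basis alpha sigma ->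
    c `<=` cone alpha sigma ->
    L (\prod_(i in sigma) linear_form (alpha i))%:F^-1
      = real_complex R (vol B (gamma_seq alpha sigma))^-1;
  JK_outside : forall sigma : {set 'I_n}, index_basis alpha sigma ->
    c `&` cone alpha sigma = set0 ->
    L (\prod_(i in sigma) linear_form (alpha i))%:F^-1 = 0;
  JK_degree : forall (d : int) (phi : ratfun), CA alpha phi ->
    homogeneous_ratfun d phi -> d != - r%:Z -> L phi = 0;
  JK_degenerate : forall (p : mpoly r R[i]) (k : 'I_n -> nat),
    <<[seq alpha i | i <- enum 'I_n & k i != 0%N]>>%VS != {:'rV[R]_r}%VS ->
    L (p%:F / (den alpha k)%:F) = 0
}.

(* Only the values on CA alpha are determined by is_JK. *)
Definition JK : ratfun -> R[i] := xget (fun=> 0) [set L | is_JK L].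

End JeffreyKirwan.

End RationalFunctions.

Section Residues.
Variable C : numClosedFieldType.

(* c is the coefficient of z^-1 in the Laurent expansion at 0 of a meromorphic
   function f: the principal part of f is the polynomial P in z^-1 (up to its
   constant term) such that f z - P.[z^-1] has a finite limit at 0. *)
Definition is_residue (f : C -> C) (c : C) : Prop :=
  exists2 P : {poly C}, P`_1 = c & cvg ((f z - P.[z^-1]) @[z --> 0^']).

Definition residue (f : C -> C) : C := xget 0 [set c | is_residue f c].

(* The residue in the first variable is taken first, the others being fixed. *)
Fixpoint iter_residue (m : nat) : ('rV[C]_m -> C) -> C :=
  match m with
  | 0 => fun f => f 0
  | m'.+1 => fun f => iter_residue (fun w : 'rV[C]_m' =>
      residue (fun z => f (row_mx (z%:M : 'M_1) w)))
  end.

End Residues.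

Section Flags.
Variables (R : realType) (r n : nat) (B : 'M[R]_r) (alpha : 'I_n -> 'rV[R]_r).

Definition flag_type := {ffun 'I_r.+1 -> {vspace 'rV[R]_r}}.

Implicit Types (F : flag_type).

Definition FL : set flag_type :=
  [set F | [/\ forall j : 'I_r.+1, \dim (F j) = j,
     forall j k : 'I_r.+1, (j <= k)%N -> (F j <= F k)%VS
   & forall j : 'I_r.+1, exists2 s : seq 'rV[R]_r,
       basis_of (F j) s & forall v, v \in s -> exists i, v = alpha i]].

(* The rows of G are gamma_1^F, ..., gamma_r^F. *)
Definition flag_basis F (G : 'M[R]_r) : Prop :=
  [/\ forall j, dual_lattice_rat B (row j G),
      positively_oriented B G,
      forall j : 'I_r.+1,
        basis_of (F j) (take j [seq row i G | i <- enum 'I_r])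
    & wedge G = dmu B].

(* phi^F (u_1, ..., u_r) is the value of phi at the solution of G *m u = w^T,
   w being the row vector of the coordinates u_j. *)
Definition Res (G : 'M[R]_r) (phi : {fraction (mpoly r R[i])}) : R[i] :=
  iter_residue (fun w : 'rV[R[i]]_r =>
    rf_eval phi (invmx (map_mx (real_complex R) G) *m w^T)).

(* Row j (counted from 0) is kappa_{j+1}^F. *)
Definition kappa F : 'M[R]_r :=
  \matrix_(j < r) \sum_(i | alpha i \in F (lift ord0 j)) alpha i.

Definition proper_flag F : bool := row_free (kappa F).

Definition nu F : int :=
  if ~~ proper_flag F then 0
  else if `[< positively_oriented B (kappa F) >] then 1 else -1.

Definition FLplus (xi : 'rV[R]_r) : set flag_type :=
  [set F | FL F /\
     exists2 t : 'I_r -> R, (forall j, 0 <= t j)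
       & xi = \sum_j t j *: row j (kappa F)].

End Flags.

(* Main.v *)
Require Import Defs.
From mathcomp Require Import fingroup perm cardinality.
From mathcomp Require Import ring lra zify.

Set Implicit Arguments.
Unset Strict Implicit.
Unset Printing Implicit Defensive.

(** The properties that define the Jeffrey-Kirwan residue determine it on
    [CA alpha], and the signed sum of iterated residues has these properties.

    Uniqueness ([JK_unique]).  Over a denominator whose forms span, a numerator
    of positive degree is a combination of the forms of the denominator and can
    be cancelled against it.  This reduces every fraction to fractions on which
    the functional is prescribed: those of degree different from [- r], those
    with a degenerate denominator, and the basic fractions, with constant
    numerator and the elements of a basis in the denominator.  For the last
    ones, connectedness of the chamber shows that it is either contained in the
    cone of the basis or disjoint from it ([chamber_cone]).

    The sum of residues ([residue_sum_is_JK]).  The coefficients of the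
    expansion in one variable of a function built from linear forms and their
    inverses are again of this kind in the remaining variables
    ([poles_in_taylor]), so all iterated residues exist and are linear.
    A function of degree different from [- r] has zero residue by homogeneity
    ([Res_homogeneous]).  The residue along a flag vanishes as soon as some step
    of the flag contains no new form of the denominator
    ([iter_residue_no_pole]); this settles degenerate denominators
    ([flag_step_missed]), and for a basic fraction it leaves only the flags
    spanned by the orderings of the basis ([flag_of_surj]), where the residue is
    the inverse of a determinant ([Res_basis]).

    The sum for a basic fraction is therefore, up to the volume, a signed count
    of the orderings for which [xi] lies in the cone of the vectors [kappa].
    Let each face of the cone of the basis be subdivided barycentrically and
    send the barycentre of the face spanned by [S] to the vector [kappa] of the
    span of [S].  This is a piecewise linear map of the cone which preserves the
    span of every face, hence is homotopic to the identity through such maps,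
    and projectivity keeps the homotopy away from 0; so its degree at [xi] is 1
    inside the cone and 0 outside.  The proof is an induction on the dimension
    ([sum_walk]): follow the ray from [xi] in the direction opposite to [kappa]
    of the whole space.  It ends up outside the cone because [kappa] has a
    positive coordinate, so the number of its exits minus that of its entries is
    1 or 0 according to whether it starts inside ([sum_orthant_crossings]), and
    every crossing takes place in a facet, where the induction hypothesis
    applies.  Regularity guarantees that all crossings are transversal; it is
    used in the form that [xi] is not spanned by fewer than [r] partial sums
    ([regular_generic]), which is inherited by the projections. *)

Local Notation "x %:F" := (tofrac x).

(** * Residues in one variable *)

Section OneVariable.
Variable C : numClosedFieldType.
Implicit Types (f g : C -> C) (a b : nat -> C) (p : {poly C}).

Lemma near0_neq : \forall z \near (0 : C)^', z != 0.
Proof. exact: nbhs_dnbhs_neq. Qed.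

Lemma cvg_near f g (l : C) : (\forall z \near 0^', f z = g z) ->
  f z @[z --> 0^'] --> l -> g z @[z --> 0^'] --> l.
Proof.
move=> fg fl; apply: cvg_trans fl; apply: near_eq_cvg.
by near=> z; near: z.
Unshelve. all: by end_near. Qed.

Lemma is_cvg_near f g : (\forall z \near 0^', f z = g z) ->
  cvg (f z @[z --> 0^']) -> cvg (g z @[z --> 0^']).
Proof. by move=> fg /cvg_ex[l fl]; apply/cvg_ex; exists l; exact: cvg_near fl. Qed.

Lemma cvg_dnbhs_id : z @[z --> (0 : C)^'] --> (0 : C).
Proof. exact: cvg_within. Qed.

Lemma cvg_horner p : p.[z] @[z --> 0^'] --> p.[0].
Proof.
elim/poly_ind: p => [|p c IH].
  rewrite horner0; apply: (@cvg_near (fun=> 0)); last exact: cvg_cst.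
  by near=> z; rewrite horner0.
rewrite hornerMXaddC; apply: (@cvg_near (fun z => p.[z] * z + c)).
  by near=> z; rewrite hornerMXaddC.
have zp : p.[z] * z @[z --> 0^'] --> p.[0] * 0 by exact: (cvgM IH cvg_dnbhs_id).
have cc : c @[z --> (0 : C)^'] --> c by exact: cvg_cst.
exact: (cvgD zp cc).
Unshelve. all: by end_near. Qed.

Arguments cvg_horner : clear implicits.

(** An asymptotic expansion to every order, with the remainder required to
    converge after division, so that no analyticity has to be established.  The
    sequence is infinite because the number of coefficients needed depends on
    the order of the pole, which grows when functions are multiplied. *)
Definition taylor f a : Prop := forall K,
  cvg ((f z - (\poly_(i < K) a i).[z]) / z ^+ K @[z --> 0^']).

Lemma taylor_near f g a :
  (\forall z \near 0^', f z = g z) -> taylor f a -> taylor g a.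
Proof.
move=> fg fa K; apply: is_cvg_near (fa K).
by apply: filterS fg => z ->.
Qed.

Lemma taylor_cvg f a : taylor f a -> cvg (f z @[z --> 0^']).
Proof.
move/(_ 0%N); apply: is_cvg_near; near=> z.
by rewrite poly_def big_ord0 horner0 subr0 divr1.
Unshelve. all: by end_near. Qed.

Lemma taylor_poly p : taylor (horner p) (fun i => p`_i).
Proof.
move=> K; apply: (@is_cvg_near (horner (drop_poly K p))); last first.
  by apply/cvg_ex; eexists; exact: cvg_horner.
near=> z.
have zN0 : z != 0 by near: z; exact: near0_neq.
rewrite -[\poly_(i < K) _]/(take_poly K p) -{2}[p](poly_take_drop K).
by rewrite !hornerE addrAC subrr add0r mulfK ?expf_neq0.
Unshelve. all: by end_near. Qed.

Arguments taylor_poly : clear implicits.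

Lemma taylorD f g a b :
  taylor f a -> taylor g b -> taylor (fun z => f z + g z) (fun i => a i + b i).
Proof.
move=> fa gb K; apply: is_cvg_near (is_cvgD (fa K) (gb K)); near=> z.
rewrite /= -mulrDl; congr (_ / _); rewrite addrACA -opprD; congr (_ - _).
by rewrite -hornerD; congr (_.[_]); apply/polyP=> i; rewrite coefD !coef_poly;
  case: ifP; rewrite ?addr0.
Unshelve. all: by end_near. Qed.

Definition cauchy_product a b i := \sum_(j < i.+1) a j * b (i - j)%N.

Lemma taylorM f g a b : taylor f a -> taylor g b ->
  taylor (fun z => f z * g z) (cauchy_product a b).
Proof.
move=> fa gb K.
set p := \poly_(i < K) a i; set q := \poly_(i < K) b i.
(* The remainder is f - p times g, plus p times g - q, plus the terms of
   degree at least K of p * q. *)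
have cp (s : {poly C}) : cvg (horner s z @[z --> 0^']).
  by apply/cvg_ex; eexists; exact: cvg_horner.
apply: is_cvg_near (is_cvgD (is_cvgM (fa K) (taylor_cvg gb))
  (is_cvgD (is_cvgM (cp p) (gb K)) (cp (drop_poly K (p * q))))); near=> z.
have zN0 : z ^+ K != 0.
  by rewrite expf_neq0 //; near: z; exact: near0_neq.
have -> : \poly_(i < K) cauchy_product a b i = take_poly K (p * q).
  apply/polyP=> i; rewrite !coef_poly; case: ifP => // iK.
  rewrite coefM; apply: eq_bigr => j _; rewrite !coef_poly.
  by rewrite (leq_ltn_trans _ iK) ?(leq_ltn_trans _ iK) ?leq_subr -1?ltnS.
have pqE : p.[z] * q.[z]
    = (take_poly K (p * q)).[z] + (drop_poly K (p * q)).[z] * z ^+ K.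
  by rewrite -hornerM -{1}[p * q](poly_take_drop K) !hornerE.
rewrite -[LHS]/((f z - p.[z]) / z ^+ K * g z + (p.[z] * ((g z - q.[z]) / z ^+ K)
  + (drop_poly K (p * q)).[z])).
have {pqE} -> : (take_poly K (p * q)).[z]
    = p.[z] * q.[z] - (drop_poly K (p * q)).[z] * z ^+ K by rewrite pqE addrK.
by field.
Unshelve. all: by end_near. Qed.

Lemma taylorV (b c : C) : b != 0 ->
  taylor (fun z => (c * z + b)^-1) (fun i => (- c) ^+ i / b ^+ i.+1).
Proof.
move=> b0 K.
have lim_den : c * z + b @[z --> (0 : C)^'] --> b.
  have cz : c * z @[z --> (0 : C)^'] --> c * 0.
    have cc : c @[z --> (0 : C)^'] --> c by exact: cvg_cst.
    exact: (cvgM cc cvg_dnbhs_id).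
  have cb : b @[z --> (0 : C)^'] --> b by exact: cvg_cst.
  by have := cvgD cz cb; rewrite mulr0 add0r; apply.
have lim_inv : (c * z + b)^-1 @[z --> (0 : C)^'] --> b^-1.
  exact: (cvgV b0 lim_den).
apply: (@is_cvg_near (fun z => (- c) ^+ K / b ^+ K * (c * z + b)^-1)); last first.
  have cc : (- c) ^+ K / b ^+ K @[z --> (0 : C)^'] --> (- c) ^+ K / b ^+ K.
    exact: cvg_cst.
  by apply/cvg_ex; eexists; exact: (cvgM cc lim_inv).
near=> z.
have z0 : z != 0 by near: z; exact: near0_neq.
have d0 : c * z + b != 0.
  near: z; exact: (@cvgr_neq0 _ _ _ _ _ _ _ lim_den b0).
elim: K => [|K IH].
  by rewrite poly_def big_ord0 horner0 !expr0 subr0 !divr1 mul1r.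
have -> : (\poly_(i < K.+1) ((- c) ^+ i / b ^+ i.+1)).[z]
   = (\poly_(i < K) ((- c) ^+ i / b ^+ i.+1)).[z] + (- c) ^+ K / b ^+ K.+1 * z ^+ K.
  by rewrite !horner_poly big_ord_recr.
have IHz := congr1 (fun x => x * z ^+ K) IH.
rewrite divfK ?expf_neq0 // in IHz.
rewrite opprD addrA -IHz !exprS.
by field; rewrite b0 z0 d0 !expf_neq0.
Unshelve. all: by end_near. Qed.

(** Principal parts are polynomials in [z^-1], Taylor polynomials are
    polynomials in [z]; this passes from one to the other. *)
Lemma horner_rev_poly N a (z : C) : z != 0 ->
  z ^+ N * (\poly_(i < N.+1) a (N - i)%N).[z^-1] = (\poly_(i < N.+1) a i).[z].
Proof.
move=> z0; rewrite !horner_poly big_distrr [RHS](reindex_inj rev_ord_inj) /=.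
apply: eq_bigr => i _; rewrite subSS mulrCA; congr (_ * _).
have iN : (i <= N)%N by rewrite -ltnS.
by rewrite -{1}(subnK iN) exprD exprVn mulfK ?expf_neq0.
Qed.

Lemma residue_taylor N f a : taylor (fun z => z ^+ N * f z) a ->
  is_residue f (if N is N'.+1 then a N' else 0).
Proof.
move=> fa; exists (\poly_(i < N.+1) a (N - i)%N).
  by rewrite coef_poly; case: N {fa} => [|N] //=; rewrite subSS subn0.
have zr : cvg (z @[z --> (0 : C)^']) by apply/cvg_ex; eexists; exact: cvg_dnbhs_id.
apply: is_cvg_near (is_cvgM (fa N.+1) zr); near=> z.
have z0 : z != 0 by near: z; exact: near0_neq.
rewrite -horner_rev_poly // -mulrBr exprSr /=.
by rewrite invfM mulrA mulfVK // mulrC mulKf // expf_neq0.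
Unshelve. all: by end_near. Qed.

(** A polynomial [d] in [z^-1] that converges at 0 is constant: multiplied by
    [z ^+ n], with [n] the degree of [d], it would tend both to 0 and to the
    leading coefficient of [d].  So the principal part in the definition of a
    residue is unique. *)
Lemma residue_unique f (x y : C) : is_residue f x -> is_residue f y -> x = y.
Proof.
move=> [p <- fp] [q <- fq]; apply/eqP; rewrite -subr_eq0 -coefB.
set d := p - q.
have [l dl] : exists l : C, d.[z^-1] @[z --> (0 : C)^'] --> l.
  apply/cvg_ex; apply: is_cvg_near (is_cvgB fq fp); near=> z.
  by rewrite /= /d hornerD hornerN -[X in _ + X]/(- (f z - p.[z^-1])); ring.
case: (leqP (size d) 1) => [sd|sd]; first by rewrite nth_default.
set n := (size d).-1; set e := \poly_(i < n.+1) d`_(n - i).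
have sdE : n.+1 = size d by rewrite prednK // ltnW.
have n0 : (0 < n)%N by rewrite -ltnS sdE.
have dE : d = \poly_(i < n.+1) d`_(n - (n - i)).
  rewrite -[LHS]coefK -sdE; apply/polyP=> i; rewrite !coef_poly.
  by case: ifP => // iN; rewrite subKn.
have e0 : e.[z] @[z --> (0 : C)^'] --> (0 : C).
  have zl : z ^+ n * d.[z^-1] @[z --> (0 : C)^'] --> (0 : C) ^+ n * l.
    have zn : z ^+ n @[z --> (0 : C)^'] --> (0 : C) ^+ n.
      have := @cvg_horner 'X^n; rewrite hornerXn.
      by apply: cvg_near; near=> z; rewrite hornerXn.
    exact: (cvgM zn dl).
  rewrite expr0n gtn_eqF // mul0r in zl; apply: cvg_near zl; near=> z.
  have z0 : z != 0 by near: z; exact: near0_neq.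
  by rewrite [in LHS]dE (horner_rev_poly n (fun i => d`_(n - i)%N)).
have : e.[0] = 0.
  apply: (cvg_unique (@norm_hausdorff _ _) (cvg_horner e) e0).
rewrite horner_coef0 coef_poly subn0 -[n]/(size d).-1 -lead_coefE /=.
by move/eqP; rewrite lead_coef_eq0 => /eqP dz; move: sd; rewrite dz size_poly0.
Unshelve. all: by end_near. Qed.

Lemma residue_near f g (x : C) : (\forall z \near 0^', f z = g z) ->
  is_residue f x -> is_residue g x.
Proof.
move=> fg [p px fp]; exists p => //; apply: is_cvg_near fp.
by apply: filterS fg => z ->.
Qed.

Lemma residueE f (x : C) : is_residue f x -> residue f = x.
Proof.
move=> fx; rewrite /residue; case: xgetP => [y _ fy|/(_ x)]; last by [].
exact: residue_unique fy fx.
Qed.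

Lemma eq_residue f g :
  (\forall z \near 0^', f z = g z) -> residue f = residue g.
Proof.
move=> fg; rewrite /residue; congr xget; apply/seteqP; split => x /=.
  exact: residue_near.
by apply: residue_near; apply: filterS fg => z ->.
Qed.

Lemma is_residue_lin f g (k x y : C) : is_residue f x -> is_residue g y ->
  is_residue (fun z => k * f z + g z) (k * x + y).
Proof.
move=> [p <- fp] [q <- gq]; exists (k *: p + q); first by rewrite coefD coefZ.
have ck : cvg (k @[z --> (0 : C)^']) by apply/cvg_ex; eexists; exact: cvg_cst.
apply: is_cvg_near (is_cvgD (is_cvgM ck fp) gq); near=> z.
by rewrite /= hornerD hornerZ; ring.
Unshelve. all: by end_near. Qed.

Lemma is_residue_scale f (k x : C) : k != 0 -> is_residue f x ->
  is_residue (fun z => f (k * z)) (x / k).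
Proof.
move=> k0 [p <- fp]; exists (\poly_(i < size p) (p`_i / k ^+ i)).
  by rewrite coef_poly; case: ltnP => [|s1] //; rewrite nth_default ?mul0r.
have kz : k * z @[z --> (0 : C)^'] --> (0 : C)^'.
  move=> A; rewrite /= /nbhs /= => nA.
  have kz0 : k * z @[z --> (0 : C)^'] --> (0 : C).
    have ck : k @[z --> (0 : C)^'] --> k by exact: cvg_cst.
    by have := cvgM ck cvg_dnbhs_id; rewrite mulr0; apply.
  have : \forall z \near (0 : C)^', k * z != 0 -> A (k * z) by exact: (kz0 _ nA).
  apply: filterS2 near0_neq => z zN0; apply.
  by rewrite mulf_neq0.
have [l fl] := (cvg_ex _).1 fp.
apply/cvg_ex; exists l.
have := cvg_comp _ _ kz fl; apply: cvg_near; near=> z => /=.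
congr (_ - _); rewrite horner_poly horner_coef; apply: eq_bigr => i _.
by rewrite invfM exprMn [k^-1 ^+ _]exprVn mulrA.
Unshelve. all: by end_near. Qed.

End OneVariable.

Arguments taylor_poly {C}.
Arguments cvg_horner {C}.
Arguments taylorV {C b} c.

(** * Iterated residues *)

Section IteratedResidues.
Variable C : numClosedFieldType.

Definition form_app m (l w : 'rV[C]_m) : C := \sum_i l 0 i * w 0 i.

Definition tail m (l : 'rV[C]_m.+1) : 'rV[C]_m := \row_i l 0 (lift ord0 i).

Definition cons_row m (z : C) (w : 'rV[C]_m) : 'rV[C]_m.+1 :=
  row_mx (z%:M : 'M_1) w.

Lemma cons_rowE m z (w : 'rV[C]_m) i :
  cons_row z w 0 i = if unlift ord0 i is Some j then w 0 j else z.
Proof.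
rewrite /cons_row; case: unliftP => [j|] ->.
  by rewrite -rshift1 (@row_mxEr _ 1 1 m).
have -> : ord0 = lshift m (0 : 'I_1) by exact: val_inj.
by rewrite (@row_mxEl _ 1 1 m) mxE eqxx mulr1n.
Qed.

Lemma form_app_cons m (l : 'rV[C]_m.+1) z w :
  form_app l (cons_row z w) = l 0 0 * z + form_app (tail l) w.
Proof.
rewrite /form_app big_ord_recl cons_rowE unlift_none; congr (_ + _).
by apply: eq_bigr => i _; rewrite cons_rowE liftK mxE.
Qed.

Lemma form_appZ m (l w : 'rV[C]_m) k : form_app l (k *: w) = k * form_app l w.
Proof.
by rewrite /form_app big_distrr; apply: eq_bigr => i _; rewrite mxE mulrCA.
Qed.

Lemma tail_eq0 m (l : 'rV[C]_m.+1) : tail l = 0 -> l != 0 -> l 0 0 != 0.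
Proof.
move=> tl0; apply: contraNneq => l0; apply/eqP/rowP => i; rewrite mxE.
case: (unliftP ord0 i) => [j|] -> //.
by have /rowP/(_ j) := tl0; rewrite !mxE.
Qed.

Definition off_hyperplanes m (A : seq 'rV[C]_m) (w : 'rV[C]_m) : Prop :=
  forall l, l \in A -> form_app l w != 0.

(** The functions that arise in an iterated residue are controlled only off
    finitely many hyperplanes. *)
Definition generically m (P : 'rV[C]_m -> Prop) : Prop :=
  exists2 A : seq 'rV[C]_m, 0 \notin A & forall w, off_hyperplanes A w -> P w.

Lemma generically_and m (P Q : 'rV[C]_m -> Prop) :
  generically P -> generically Q -> generically (fun w => P w /\ Q w).
Proof.
move=> [A A0 AP] [B B0 BQ]; exists (A ++ B).
  by rewrite mem_cat negb_or A0.
by move=> w wAB; split; [apply: AP|apply: BQ] => l lA; apply: wAB;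
  rewrite mem_cat lA ?orbT.
Qed.

Lemma generically_impl m (P Q : 'rV[C]_m -> Prop) :
  (forall w, P w -> Q w) -> generically P -> generically Q.
Proof. by move=> PQ [A A0 AP]; exists A => // w /AP/PQ. Qed.

Lemma generically_all m (P : 'rV[C]_m -> Prop) : (forall w, P w) -> generically P.
Proof. by move=> PA; exists [::]. Qed.

Lemma generically_form m (l : 'rV[C]_m) :
  l != 0 -> generically (fun w => form_app l w != 0).
Proof.
move=> l0; exists [:: l]; first by rewrite inE eq_sym.
by move=> w; apply; rewrite inE.
Qed.

Lemma generically_forms m (I : finType) (l : I -> 'rV[C]_m) :
  (forall i, l i != 0) ->
  generically (fun w : 'rV[C]_m => forall i, form_app (l i) w != 0).
Proof.
move=> l0; exists [seq l i | i <- enum I].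
  by apply/mapP => -[i _] /esym/eqP; exact/negP.
by move=> w wA i; apply: wA; apply: map_f; rewrite mem_enum.
Qed.

Lemma generically_scale m (P : 'rV[C]_m -> Prop) k :
  k != 0 -> generically P -> generically (fun w => P (k *: w)).
Proof.
move=> k0 [A A0 AP]; exists A => // w wA; apply: AP => l lA.
by rewrite form_appZ mulf_neq0 // wA.
Qed.

(** The hyperplanes of equation [tail l = 0] are the traces at [z = 0] of the
    hyperplanes [l = 0].  Over a point [w] off these traces, a hyperplane meets
    the line of points [(z, w)] at most once, hence misses all small [z != 0]. *)
Lemma generically_cons m (P : 'rV[C]_m.+1 -> Prop) : generically P ->
  generically (fun w => \forall z \near (0 : C)^', P (cons_row z w)).
Proof.
move=> [A A0 AP]; exists [seq tail l | l <- A & tail l != 0].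
  by apply/mapP => -[l]; rewrite mem_filter => /andP[l0 _] /eqP; rewrite eq_sym (negbTE l0).
move=> w wA; suff : \forall z \near (0 : C)^', off_hyperplanes A (cons_row z w).
  by apply: filterS => z /AP.
elim: A A0 wA {AP} => [|l A IH] /=; first by move=> _ _; near=> z.
rewrite inE negb_or => /andP[l0 A0] wA.
have lz : \forall z \near (0 : C)^', form_app l (cons_row z w) != 0.
  have [tl0|tl0] := eqVneq (tail l) 0.
    apply: filterS (near0_neq C) => z z0; rewrite form_app_cons tl0.
    rewrite [form_app 0 w]big1 => [|i _]; last by rewrite mxE mul0r.
    by rewrite addr0 mulf_neq0 // tail_eq0 // eq_sym.
  have lw : form_app (tail l) w != 0.
    by apply: wA; rewrite tl0 inE eqxx.
  have cv := cvg_horner (l 0 0 *: 'X + (form_app (tail l) w)%:P).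
  rewrite !hornerE in cv.
  apply: filterS (cvgr_neq0 _ cv lw) => z.
  by rewrite !hornerE form_app_cons.
have Az : \forall z \near (0 : C)^', off_hyperplanes A (cons_row z w).
  by apply: IH => // k kA; apply: wA; case: ifP => // _; rewrite inE kA orbT.
apply: filterS2 lz Az => z lz Az k.
by rewrite inE => /orP[/eqP->|/Az].
Unshelve. all: by end_near. Qed.

(** A residue depends only on the values near 0, so exceptional values on
    hyperplanes are never seen. *)
Lemma eq_iter_residue m (f g : 'rV[C]_m -> C) :
  generically (fun w => f w = g w) -> iter_residue f = iter_residue g.
Proof.
elim: m => [|m IH] in f g *.
  by move=> [A A0 fg] /=; apply: fg => l lA; case/negP: A0; rewrite -[0](thinmx0 l).
move=> fg /=; apply: IH; apply: generically_impl (generically_cons fg) => w fgw.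
exact: eq_residue.
Qed.

(** A relational form of [iter_residue], which also asserts the existence of
    every residue taken on the way. *)
Fixpoint is_iter_residue m : ('rV[C]_m -> C) -> C -> Prop :=
  match m with
  | 0 => fun f c => f 0 = c
  | m'.+1 => fun f c => exists2 g : 'rV[C]_m' -> C,
      generically (fun w => is_residue (fun z => f (cons_row z w)) (g w))
      & is_iter_residue g c
  end.

Lemma iter_residueE m (f : 'rV[C]_m -> C) c :
  is_iter_residue f c -> iter_residue f = c.
Proof.
elim: m => [|m IH] in f c * => //= -[g fg /IH <-].
apply: eq_iter_residue; apply: generically_impl fg => w; exact: residueE.
Qed.

Lemma is_iter_residue_generic m (f g : 'rV[C]_m -> C) c :
  generically (fun w => f w = g w) -> is_iter_residue f c -> is_iter_residue g c.
Proof.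
case: m => [|m] in f g *.
  by move=> [A A0 fg] /= <-; rewrite -fg // => l lA; case/negP: A0; rewrite -[0](thinmx0 l).
move=> fg /= [h fh hc]; exists h => //.
have := generically_and (generically_cons fg) fh.
by apply: generically_impl => w [fgw]; exact: residue_near.
Qed.

Lemma is_iter_residue_lin m (f g : 'rV[C]_m -> C) k x y :
  is_iter_residue f x -> is_iter_residue g y ->
  is_iter_residue (fun w => k * f w + g w) (k * x + y).
Proof.
elim: m => [|m IH] in f g x y *; first by move=> /= <- <-.
move=> /= [f' ff' fx] [g' gg' gy].
exists (fun w => k * f' w + g' w); last exact: IH.
apply: generically_impl (generically_and ff' gg') => w [fw gw].
exact: is_residue_lin.
Qed.

Lemma is_residue0 : @is_residue C (fun=> 0) 0.
Proof.
exists 0; first by rewrite coef0.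
apply: (@is_cvg_near _ (fun=> 0)); last by apply/cvg_ex; eexists; exact: cvg_cst.
by near=> z; rewrite horner0 subr0.
Unshelve. all: by end_near. Qed.

Lemma is_iter_residue0 m : is_iter_residue (fun _ : 'rV[C]_m => 0) 0.
Proof.
elim: m => [|m IH] //=; exists (fun=> 0) => //.
by apply: generically_all => w; exact: is_residue0.
Qed.

Lemma is_iter_residue_scale m (f : 'rV[C]_m -> C) k x : k != 0 ->
  is_iter_residue f x -> is_iter_residue (fun w => f (k *: w)) (x / k ^+ m).
Proof.
move=> k0; elim: m => [|m IH] in f x *.
  by rewrite /= scaler0 expr0 divr1.
move=> /= [g fg /IH gx]; exists (fun w => k^-1 * g (k *: w) + 0); last first.
  have := is_iter_residue_lin k^-1 gx (is_iter_residue0 m).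
  by rewrite addr0 exprS invfM mulrCA mulrA.
apply: generically_impl (generically_scale k0 fg) => w fw.
rewrite addr0 mulrC; have := is_residue_scale k0 fw.
apply: residue_near; near=> z; congr f; apply/rowP=> i.
by rewrite [RHS]mxE !cons_rowE; case: unlift => // j; rewrite mxE.
Unshelve. all: by end_near. Qed.

(** The functions obtained by adding and multiplying constants, linear forms
    and inverses of linear forms satisfying [Q].  Following [Q] through the
    successive residues locates their poles. *)
Inductive poles_in m (Q : 'rV[C]_m -> Prop) : ('rV[C]_m -> C) -> Prop :=
| poles_in_cst c : poles_in Q (fun=> c)
| poles_in_form l : poles_in Q (form_app l)
| poles_in_inv l : Q l -> l != 0 -> poles_in Q (fun w => (form_app l w)^-1)
| poles_in_add f g :
    poles_in Q f -> poles_in Q g -> poles_in Q (fun w => f w + g w)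
| poles_in_mul f g :
    poles_in Q f -> poles_in Q g -> poles_in Q (fun w => f w * g w).

Lemma poles_in_sum m (Q : 'rV[C]_m -> Prop) I (r : seq I) (f : I -> 'rV[C]_m -> C) :
  (forall i, poles_in Q (f i)) -> poles_in Q (fun w => \sum_(i <- r) f i w).
Proof.
move=> fQ; elim: r => [|i r IH].
  rewrite (_ : (fun w => _) = fun=> 0); first exact: poles_in_cst.
  by apply/funext => w; rewrite big_nil.
rewrite (_ : (fun w => _) = fun w => f i w + \sum_(i <- r) f i w).
  exact: poles_in_add.
by apply/funext => w; rewrite big_cons.
Qed.

Lemma poles_in_prod m (Q : 'rV[C]_m -> Prop) I (r : seq I) (f : I -> 'rV[C]_m -> C) :
  (forall i, poles_in Q (f i)) -> poles_in Q (fun w => \prod_(i <- r) f i w).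
Proof.
move=> fQ; elim: r => [|i r IH].
  rewrite (_ : (fun w => _) = fun=> 1); first exact: poles_in_cst.
  by apply/funext => w; rewrite big_nil.
rewrite (_ : (fun w => _) = fun w => f i w * \prod_(i <- r) f i w).
  exact: poles_in_mul.
by apply/funext => w; rewrite big_cons.
Qed.

Definition tail_pred m (Q : 'rV[C]_m.+1 -> Prop) (b : 'rV[C]_m) : Prop :=
  exists2 l, Q l & tail l = b.

(** In the first variable [z], the inverse of a form is a geometric series in
    [z] unless its tail vanishes; in that case it is a multiple of [z^-1], and
    this is the only source of poles. *)
Lemma poles_in_taylor m (Q : 'rV[C]_m.+1 -> Prop) f : poles_in Q f ->
  exists N (a : nat -> 'rV[C]_m -> C),
    [/\ forall i, poles_in (tail_pred Q) (a i),
        generically (fun w =>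
          taylor (fun z => z ^+ N * f (cons_row z w)) (a ^~ w))
      & (forall l, Q l -> l != 0 -> tail l != 0) -> N = 0%N].
Proof.
elim=> {f} [c|l|l Ql l0|f g _ [N [a [aQ fa N0]]] _ [M [b [bQ gb M0]]]
           |f g _ [N [a [aQ fa N0]]] _ [M [b [bQ gb M0]]]].
- exists 0%N, (fun i _ => c%:P`_i); split=> //.
    by move=> i; exact: poles_in_cst.
  apply: generically_all => w; apply: (@taylor_near _ (horner c%:P)); last exact: taylor_poly.
  by near=> z; rewrite expr0 mul1r hornerC.
- exists 0%N, (fun i w => (l 0 0 *: 'X + (form_app (tail l) w)%:P)`_i); split=> //.
    move=> i; rewrite (_ : (fun w => _) = fun w => (l 0 0 *: 'X)`_i
       + (i == 0%N)%:R * form_app (tail l) w); last first.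
      by apply/funext => w; rewrite coefD coefC; case: eqP; rewrite ?mul1r ?mul0r.
    apply: poles_in_add; first exact: poles_in_cst.
    by apply: poles_in_mul; [exact: poles_in_cst | exact: poles_in_form].
  apply: generically_all => w.
  apply: taylor_near (taylor_poly (l 0 0 *: 'X + (form_app (tail l) w)%:P)).
  by near=> z; rewrite expr0 mul1r form_app_cons !hornerE.
- have [tl0|tl0] := eqVneq (tail l) 0.
    exists 1%N, (fun i _ => ((l 0 0)^-1)%:P`_i); split.
    + by move=> i; exact: poles_in_cst.
    + apply: generically_all => w; apply: taylor_near (taylor_poly (l 0 0)^-1%:P).
      near=> z; have z0 : z != 0 by near: z; exact: near0_neq.
      rewrite hornerC form_app_cons tl0 [form_app 0 w]big1 => [|i _]; last first.
        by rewrite mxE mul0r.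
      by rewrite addr0 invfM expr1 mulrCA divff ?mulr1.
    + by move/(_ l Ql l0); rewrite tl0 eqxx.
  exists 0%N, (fun i w => (- l 0 0) ^+ i / form_app (tail l) w ^+ i.+1); split => //.
    move=> i; apply: poles_in_mul; first exact: poles_in_cst.
    rewrite (_ : (fun w => _) = fun w => \prod_(j < i.+1) (form_app (tail l) w)^-1).
      by apply: poles_in_prod => j; apply: poles_in_inv => //; exists l.
    by apply/funext => w; rewrite prodr_const card_ord exprVn.
  apply: generically_impl (generically_form tl0) => w lw.
  apply: taylor_near (taylorV (l 0 0) lw).
  by near=> z; rewrite expr0 mul1r form_app_cons.
- exists (N + M)%N, (fun i w => cauchy_product (fun i => ('X^M : {poly C})`_i) (a ^~ w) i
    + cauchy_product (fun i => ('X^N : {poly C})`_i) (b ^~ w) i); split.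
  + move=> i; apply: poles_in_add; apply: poles_in_sum => j;
      by apply: poles_in_mul => //; exact: poles_in_cst.
  + apply: generically_impl (generically_and fa gb) => w [fw gw].
    apply: taylor_near (taylorD (taylorM (taylor_poly 'X^M) fw)
                                (taylorM (taylor_poly 'X^N) gw)).
    by near=> z; rewrite !hornerXn exprD -!mulrA; set u := f _; set v := g _; ring.
  + by move=> H; rewrite N0 // M0.
- exists (N + M)%N, (fun i w => cauchy_product (a ^~ w) (b ^~ w) i); split.
  + by move=> i; apply: poles_in_sum => j; exact: poles_in_mul.
  + apply: generically_impl (generically_and fa gb) => w [fw gw].
    apply: taylor_near (taylorM fw gw).
    by near=> z; rewrite exprD; ring.
  + by move=> H; rewrite N0 // M0.
Unshelve. all: by end_near. Qed.

Lemma poles_in_residue m (Q : 'rV[C]_m.+1 -> Prop) f : poles_in Q f ->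
  exists g, [/\ poles_in (tail_pred Q) g,
    generically (fun w => is_residue (fun z => f (cons_row z w)) (g w))
    & (forall l, Q l -> l != 0 -> tail l != 0) -> g = fun=> 0].
Proof.
move=> /poles_in_taylor[N [a [aQ fa N0]]].
exists (fun w => if N is N'.+1 then a N' w else 0); split.
- by case: N {fa N0} => [|N]; [exact: poles_in_cst | exact: aQ].
- by apply: generically_impl fa => w; exact: residue_taylor.
- by move=> /N0 ->.
Qed.

Lemma poles_in_iter_residue m (Q : 'rV[C]_m -> Prop) f :
  poles_in Q f -> exists x, is_iter_residue f x.
Proof.
elim: m => [|m IH] in Q f *; first by exists (f 0).
by move=> /poles_in_residue[g [/IH[x gx] fg _]]; exists x; exists g.
Qed.

Definition last_nonzero m (l : 'rV[C]_m) (j : nat) : Prop :=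
  exists i : 'I_m, [/\ i = j :> nat, l 0 i != 0
    & forall k : 'I_m, (j < k)%N -> l 0 k = 0].

(** When the [j]-th residue is taken, the variables of smaller index have been
    set to 0, so that only a form whose last nonzero coordinate is the [j]-th
    one can produce a pole. *)
Lemma iter_residue_no_pole m (Q : 'rV[C]_m -> Prop) f j : (j < m)%N ->
  (forall l, Q l -> ~ last_nonzero l j) -> poles_in Q f -> is_iter_residue f 0.
Proof.
elim: m => [|m IH] in Q f j * => // jm Qj /poles_in_residue[g [gQ fg g0]].
case: j => [|j] in jm Qj *.
  exists g => //; rewrite g0; first exact: is_iter_residue0.
  move=> l Ql l0; apply/eqP => tl0; apply: (Qj l Ql); exists ord0; split => //.
    exact: tail_eq0.
  move=> k; case: (unliftP ord0 k) => [k'|] -> // _.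
  by have /rowP/(_ k') := tl0; rewrite !mxE.
exists g => //; apply: (IH (tail_pred Q) g j) => // b [l Ql <-] [i [ij li lk]].
apply: (Qj l Ql); exists (lift ord0 i); split.
- by rewrite /= /bump leq0n ij.
- by rewrite mxE in li.
- move=> k; case: (unliftP ord0 k) => [k'|] -> //.
  by rewrite /= /bump leq0n ltnS => /lk; rewrite mxE.
Qed.

Lemma taylor_prod (I : Type) (r : seq I) (F : I -> C -> C) (x : I -> C) :
  (forall i, exists2 a, taylor (F i) a & a 0%N = x i) ->
  exists2 a, taylor (fun z => \prod_(i <- r) F i z) a & a 0%N = \prod_(i <- r) x i.
Proof.
move=> Fx; elim: r => [|i r [b fb b0]].
  exists (fun i => (1 : {poly C})`_i); last by rewrite big_nil coef1.
  by apply: taylor_near (taylor_poly 1); near=> z; rewrite big_nil hornerC.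
have [a fa a0] := Fx i; exists (cauchy_product a b).
  by apply: taylor_near (taylorM fa fb); near=> z; rewrite big_cons.
by rewrite big_cons /cauchy_product big_ord1 subn0 a0 b0.
Unshelve. all: by end_near. Qed.

(** Triangularity leaves only the first form with a pole at [z = 0]; taking
    the residue replaces it by its coefficient and sets [z] to 0 in the others. *)
Lemma iter_residue_triangular m (M : 'M[C]_m) : is_trig_mx M ->
  (forall i, M i i != 0) ->
  is_iter_residue (fun w => \prod_i (form_app (row i M) w)^-1) (\prod_i (M i i)^-1).
Proof.
elim: m => [|m IH] in M *; first by rewrite /= !big_ord0.
move=> /is_trig_mxP Mt Md /=.
pose M' := \matrix_(i, j) M (lift ord0 i) (lift ord0 j) : 'M[C]_m.
have tailM i : tail (row (lift ord0 i) M) = row i M'.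
  by apply/rowP => j; rewrite !mxE.
have tail0 : tail (row ord0 M) = 0.
  by apply/rowP => j; rewrite !mxE Mt.
exists (fun w => (M 0 0)^-1 * \prod_i (form_app (row i M') w)^-1 + 0); last first.
  rewrite big_ord_recl -[_ * _]addr0.
  apply: is_iter_residue_lin; last exact: is_iter_residue0.
  have -> : \prod_(i < m) (M (lift ord0 i) (lift ord0 i))^-1
       = \prod_(i < m) (M' i i)^-1 by apply: eq_bigr => i _; rewrite mxE.
  apply: IH; last by move=> i; rewrite mxE.
  by apply/is_trig_mxP => i j ij; rewrite mxE Mt // /= /bump !leq0n.
have M'0 i : row i M' != 0.
  by apply/eqP => /rowP/(_ i)/eqP; rewrite !mxE (negbTE (Md _)).
apply: generically_impl (generically_forms M'0) => w wM; rewrite addr0.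
have [a Fa a0] := @taylor_prod _ (index_enum 'I_m)
  (fun i z => (M (lift ord0 i) 0 * z + form_app (row i M') w)^-1)
  (fun i => (form_app (row i M') w)^-1)
  (fun i => ex_intro2 _ _ _ (taylorV (M (lift ord0 i) 0) (wM i)) (mul1r _)).
have := @residue_taylor C 1
  (fun z => (M 0 0)^-1 * z^-1 *
     \prod_i (M (lift ord0 i) 0 * z + form_app (row i M') w)^-1)
  (cauchy_product (fun i => ((M 0 0)^-1)%:P`_i) a).
rewrite /= /cauchy_product big_ord1 subn0 a0 coefC eqxx.
move=> res; apply: residue_near (res _).
  near=> z; rewrite big_ord_recl form_app_cons tail0 [form_app 0 w]big1; last first.
    by move=> i _; rewrite mxE mul0r.
  rewrite addr0 invfM mxE; congr (_ * _).
  by apply: eq_bigr => i _; rewrite form_app_cons tailM mxE.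
apply: taylor_near (taylorM (taylor_poly (M 0 0)^-1%:P) Fa).
near=> z; have z0 : z != 0 by near: z; exact: near0_neq.
by rewrite hornerC expr1 !mulrA; congr (_ * _); rewrite mulrAC divff // mul1r.
Unshelve. all: by end_near. Qed.

End IteratedResidues.

(** * Leaving the positive orthant along a ray *)

(** The [i]-th term is nonzero when the ray [x - t k], [t >= 0], crosses the
    relative interior of the [i]-th facet of the positive orthant; its sign is
    positive where the ray leaves the orthant and negative where it enters.
    As the ray ends up outside the orthant, the total is 1 if it starts inside
    and 0 otherwise. *)
Lemma sum_orthant_crossings (R : realFieldType) (T : finType) (S : {set T})
    (x k : T -> R) :
  (exists2 i, i \in S & 0 < k i) -> (forall i, i \in S -> x i != 0) ->
  (forall i j, i \in S -> j \in S -> j != i -> k i != 0 ->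
     x j - x i / k i * k j != 0) ->
  \sum_(i in S) Num.sg (k i) * (0 <= x i / k i)%R%:R
     * [forall (j | j \in S :\ i), 0 < x j - x i / k i * k j]%R%:R
  = [forall (j | j \in S), 0 < x j]%R%:R :> R.
Proof.
move=> [i0 i0S ki0] x0 xk.
pose t i := x i / k i.
(* The ray meets the i-th coordinate hyperplane at the time t i, so only its
   first exit a and its last entry b can contribute. *)
have xE i : k i != 0 -> x i = t i * k i by move=> ki; rewrite divfK.
pose Z := [forall (j | (j \in S) && (k j == 0)), 0 < x j].
have ZP j : Z -> j \in S -> k j = 0 -> 0 < x j.
  by move=> /forall_inP/(_ j) H jS kj; apply: H; rewrite jS kj eqxx.
case: (@arg_minP _ _ _ i0 (fun i => (i \in S) && (0 < k i)) t).
  by rewrite i0S.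
move=> a /andP[aS ka] amin.
have ka0 : k a != 0 by rewrite gt_eqF.
have ta0 : t a != 0 by rewrite mulf_neq0 ?invr_eq0 // x0.
have posa j : j \in S -> j != a -> 0 < k j -> 0 < x j - t a * k j.
  move=> jS ja kj; rewrite lt0r xk //= xE ?gt_eqF // -mulrBl.
  by rewrite mulr_ge0 ?(ltW kj) // subr_ge0 amin // jS.
have term0 i : i \in S -> i != a -> 0 < k i ->
    [forall (j | j \in S :\ i), 0 < x j - x i / k i * k j] = false.
  move=> iS ia ki; apply/negP => /forall_inP/(_ a).
  rewrite !inE eq_sym ia aS => /(_ isT); apply/negP; rewrite -leNgt.
  rewrite (xE a) // -mulrBl mulr_le0_ge0 ?(ltW ka) // subr_le0 amin //.
  by rewrite iS.
case: (pickP (fun i => (i \in S) && (k i < 0))) => [b0 /andP[b0S kb0]|noneg].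
- case: (@arg_maxP _ _ _ b0 (fun i => (i \in S) && (k i < 0)) t).
    by rewrite b0S.
  move=> b /andP[bS kb] bmax.
  have kbn : k b != 0 by rewrite lt_eqF.
  have tb0 : t b != 0 by rewrite mulf_neq0 ?invr_eq0 // x0.
  have ba : b != a by apply/eqP => ba; rewrite ba in kb; lra.
  have posb j : j \in S -> j != b -> k j < 0 -> 0 < x j - t b * k j.
    move=> jS jb kj; rewrite lt0r xk //= xE ?lt_eqF // -mulrBl.
    by rewrite mulr_le0 ?(ltW kj) // subr_le0; apply: bmax; rewrite jS.
  rewrite (bigD1 a) //= (bigD1 b) /= ?bS // big1 ?addr0; last first.
    move=> i /andP[/andP[iS ia] ib]; case: (ltgtP (k i) 0) => ki.
    + have -> : [forall (j | j \in S :\ i), 0 < x j - x i / k i * k j] = false.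
        apply/negP => /forall_inP/(_ b).
        rewrite !inE eq_sym ib bS => /(_ isT); apply/negP; rewrite -leNgt.
        rewrite (xE b) // -mulrBl mulr_ge0_le0 ?(ltW kb) // subr_ge0; apply: bmax.
        by rewrite iS.
      by rewrite mulr0.
    + by rewrite term0 ?mulr0.
    + by rewrite ki sgr0 !mul0r.
  have -> : [forall (j | j \in S :\ a), 0 < x j - x a / k a * k j]
      = Z && (t b < t a).
    apply/idP/idP => [/forall_inP H|/andP[HZ tba]].
      apply/andP; split.
        apply/forall_inP => j /andP[jS /eqP kj].
        have := H j; rewrite !inE jS kj mulr0 subr0; apply.
        by rewrite andbT; apply/eqP => ja; rewrite ja in kj; rewrite kj eqxx in ka0.
      have := H b; rewrite !inE ba bS => /(_ isT).
      by rewrite {1}(xE b) // -mulrBl nmulr_lgt0 // subr_lt0.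
    apply/forall_inP => j; rewrite !inE => /andP[ja jS].
    case: (ltgtP (k j) 0) => kj; last by rewrite kj mulr0 subr0 ZP.
      rewrite (xE j) ?lt_eqF // -mulrBl nmulr_lgt0 // subr_lt0.
      by apply: le_lt_trans tba; apply: bmax; rewrite jS.
    exact: posa.
  have -> : [forall (j | j \in S :\ b), 0 < x j - x b / k b * k j]
      = Z && (t b < t a).
    apply/idP/idP => [/forall_inP H|/andP[HZ tba]].
      apply/andP; split.
        apply/forall_inP => j /andP[jS /eqP kj].
        have := H j; rewrite !inE jS kj mulr0 subr0; apply.
        by rewrite andbT; apply/eqP => jb; rewrite jb in kj; rewrite kj eqxx in kbn.
      have := H a; rewrite !inE eq_sym ba aS => /(_ isT).
      by rewrite {1}(xE a) // -mulrBl pmulr_lgt0 // subr_gt0.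
    apply/forall_inP => j; rewrite !inE => /andP[jb jS].
    case: (ltgtP (k j) 0) => kj; last by rewrite kj mulr0 subr0 ZP.
      exact: posb.
    rewrite (xE j) ?gt_eqF // -mulrBl pmulr_lgt0 // subr_gt0.
    by apply: lt_le_trans tba _; apply: amin; rewrite jS.
  have -> : [forall (j | j \in S), 0 < x j] = [&& Z, t b < 0 & 0 < t a].
    apply/idP/idP => [/forall_inP H|/and3P[HZ tb ta]].
      apply/and3P; split.
      + by apply/forall_inP => j /andP[jS _]; exact: H.
      + by rewrite -(nmulr_lgt0 _ kb) -xE // H.
      + by rewrite -(pmulr_lgt0 _ ka) -xE // H.
    apply/forall_inP => j jS; case: (ltgtP (k j) 0) => kj; last exact: ZP.
      rewrite (xE j) ?lt_eqF // nmulr_lgt0 //.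
      by apply: le_lt_trans tb; apply: bmax; rewrite jS.
    rewrite (xE j) ?gt_eqF // pmulr_lgt0 //.
    by apply: lt_le_trans ta _; apply: amin; rewrite jS.
  rewrite (gtr0_sg ka) (ltr0_sg kb) -/(t a) -/(t b).
  move: ta0 tb0; case: {+}Z => /=; last by rewrite !mulr0 addr0.
  move: (t a) (t b) => u v u0 v0.
  case: (ltgtP u 0) u0 => // u0 _; case: (ltgtP v 0) v0 => // v0 _;
    case: (ltgtP v u) => vu; rewrite ?mulr0 ?mulr1 ?mul1r ?mul0r ?addr0 ?add0r ?subrr //=; lra.
- rewrite (bigD1 a) //= big1 ?addr0; last first.
    move=> i /andP[iS ia]; case: (ltgtP (k i) 0) => ki.
    + by have := noneg i; rewrite iS ki.
    + by rewrite term0 ?mulr0.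
    + by rewrite ki sgr0 !mul0r.
  have -> : [forall (j | j \in S :\ a), 0 < x j - x a / k a * k j] = Z.
    apply/idP/idP => [/forall_inP H|HZ]; apply/forall_inP => j.
      move=> /andP[jS /eqP kj]; have := H j; rewrite !inE jS kj mulr0 subr0; apply.
      by rewrite andbT; apply/eqP => ja; rewrite ja in kj; rewrite kj eqxx in ka0.
    rewrite !inE => /andP[ja jS].
    case: (ltgtP (k j) 0) => kj; last by rewrite kj mulr0 subr0 ZP.
      by have := noneg j; rewrite jS kj.
    exact: posa.
  have -> : [forall (j | j \in S), 0 < x j] = Z && (0 < t a).
    apply/idP/idP => [/forall_inP H|/andP[HZ ta]].
      apply/andP; split.
      + by apply/forall_inP => j /andP[jS _]; exact: H.
      + by rewrite -(pmulr_lgt0 _ ka) -xE // H.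
    apply/forall_inP => j jS; case: (ltgtP (k j) 0) => kj; last exact: ZP.
      by have := noneg j; rewrite jS kj.
    rewrite (xE j) ?gt_eqF // pmulr_lgt0 //.
    by apply: lt_le_trans ta _; apply: amin; rewrite jS.
  by rewrite gtr0_sg // mul1r -/(t a) le_eqVlt eq_sym (negbTE ta0) /= -natrM mulnb andbC.
Qed.

(** * Counting the flags of a basis that contain a vector in their cone *)

Section Dot.
Variables (R : realType) (r : nat).
Implicit Types (x y : 'rV[R]_r) (v : 'cV[R]_r).

Definition dot x v : R := (x *m v) 0 0.

Lemma dotB x y v : dot (x - y) v = dot x v - dot y v.
Proof. by rewrite /dot mulmxBl !mxE. Qed.

Lemma dotZ a x v : dot (a *: x) v = a * dot x v.
Proof. by rewrite /dot -scalemxAl !mxE. Qed.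

Lemma dot_sum I (s : seq I) (P : pred I) (F : I -> 'rV[R]_r) v :
  dot (\sum_(i <- s | P i) F i) v = \sum_(i <- s | P i) dot (F i) v.
Proof. by rewrite /dot mulmx_suml summxE. Qed.

End Dot.

Section TupleSums.
Variables (R : nmodType) (T : finType).

Lemma big_tuple_cons d (P : pred (d.+1.-tuple T)) (f : d.+1.-tuple T -> R) :
  \sum_(s | P s) f s
  = \sum_i \sum_(s : d.-tuple T | P (cons_tuple i s)) f (cons_tuple i s).
Proof.
rewrite (pair_big_dep predT (fun i s => P (cons_tuple i s))
  (fun i s => f (cons_tuple i s))) /=.
rewrite (reindex (fun p : T * d.-tuple T => cons_tuple p.1 p.2)) //=.
exists (fun s => (thead s, behead_tuple s)) => /= [[i s] _ | s _].
  by congr (_, _); exact: val_inj.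
by rewrite [s in RHS]tuple_eta; exact: val_inj.
Qed.

Lemma sum_enumerations d (S : {set T}) (f : d.+1.-tuple T -> R) :
  \sum_(s : d.+1.-tuple T | uniq s && ([set i in s]%SET == S)) f s
  = \sum_(i in S)
      \sum_(s : d.-tuple T | uniq s && ([set j in s]%SET == (S :\ i)%SET))
        f (cons_tuple i s).
Proof.
rewrite big_tuple_cons (bigID (mem S)) /= [X in _ + X]big1 ?addr0; last first.
  move=> i iS; rewrite big1 // => s /andP[_ /eqP sS]; move: iS.
  by rewrite -sS !inE eqxx.
apply: eq_bigr => i iS; apply: eq_bigl => s.
have [is_|is_] := boolP (i \in s); rewrite /= ?andbF ?andFb.
  apply/esym/negP => /andP[_ /eqP/setP/(_ i)].
  by rewrite !inE eqxx is_.
congr (_ && _); apply/eqP/eqP => [<-|sS].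
  apply/setP => j; rewrite !inE; have [->|//] := eqVneq j i.
  by rewrite (negbTE is_).
apply/setP => j; rewrite !inE; have := congr1 (fun A : {set T} => j \in A) sS.
by rewrite !inE => ->; have [->|//] := eqVneq j i; rewrite iS.
Qed.

End TupleSums.

Section FlagWalk.
Variables (R : realType) (r n : nat) (alpha : 'I_n -> 'rV[R]_r).
Implicit Types (V : {vspace 'rV[R]_r}) (x : 'rV[R]_r) (s : seq 'I_n) (S : {set 'I_n}).

Definition kappa_of V : 'rV[R]_r := \sum_(i | alpha i \in V) alpha i.

Definition span_of s : {vspace 'rV[R]_r} := <<[seq alpha i | i <- s]>>%VS.

Lemma kappa_of_mem V : kappa_of V \in V.
Proof. exact: memv_suml. Qed.

Lemma kappa_of_partial_sum V : partial_sums alpha (kappa_of V).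
Proof.
exists [set i | alpha i \in V]%SET.
by apply: eq_bigl => i; rewrite inE.
Qed.

Lemma alpha_partial_sum i : partial_sums alpha (alpha i).
Proof. by exists [set i]%SET; rewrite big_set1. Qed.

Lemma mem_span_of s i : i \in s -> alpha i \in span_of s.
Proof. by move=> is_; apply: memv_span; apply: map_f. Qed.

Lemma eq_span_of s s' : s =i s' -> span_of s = span_of s'.
Proof.
move=> ss'; apply: eq_span => v; apply/mapP/mapP => -[i is_ ->]; exists i => //.
  by rewrite -ss'.
by rewrite ss'.
Qed.

Lemma span_of_sum s x : uniq s -> x \in span_of s ->
  exists a : 'I_n -> R, x = \sum_(i <- s) a i *: alpha i.
Proof.
rewrite /span_of; elim: s => [|i s IH] in x *.
  by move=> _; rewrite span_nil memv0 => /eqP ->; exists (fun=> 0); rewrite big_nil.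
rewrite /= span_cons => /andP[is_ us] /memv_addP[_ /vlineP[k ->] [y ys ->]].
have [a ->] := IH y us ys.
exists (fun j => if j == i then k else a j); rewrite big_cons eqxx; congr (_ + _).
by apply: eq_big_seq => j js; case: eqP => // ji; rewrite -ji js in is_.
Qed.

(** Genericity in a form that is stable under the projection along a partial
    sum [k]: if [x - t k] lies in the span of [m] partial sums, then [x] lies
    in the span of [m + 1] of them. *)
Definition generic_vector (d : nat) x : Prop := forall s : seq 'rV[R]_r,
  (forall v, v \in s -> partial_sums alpha v) -> (size s < d)%N ->
  x \notin <<s>>%VS.

Lemma generic_vector_sub d x t V : generic_vector d.+1 x ->
  generic_vector d (x - t *: kappa_of V).
Proof.
move=> gx s sA sd; apply/negP => xs.
have := gx (kappa_of V :: s).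
have -> // : x \in <<kappa_of V :: s>>%VS.
  rewrite span_cons -(subrK (t *: kappa_of V) x) addrC memv_add //.
  by rewrite memvZ // memv_line.
move=> /(_ _ sd) H; suff: false by []. apply: H => v.
by rewrite inE => /orP[/eqP->|/sA //]; exact: kappa_of_partial_sum.
Qed.

Variables (sigma : {set 'I_n}) (co : 'I_n -> 'cV[R]_r).
Hypothesis co_dual : forall i j, i \in sigma -> j \in sigma ->
  dot (alpha i) (co j) = (i == j)%:R.

Lemma dot_co_sum s (a : 'I_n -> R) j : uniq s -> {subset s <= sigma} ->
  j \in sigma ->
  dot (\sum_(i <- s) a i *: alpha i) (co j) = if j \in s then a j else 0.
Proof.
move=> us ss js; rewrite dot_sum; case: ifPn => jsn.
  rewrite (bigD1_seq j) //= dotZ co_dual // eqxx mulr1 big_seq_cond big1 ?addr0 //.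
  by move=> i /andP[is_ /negbTE ij]; rewrite dotZ co_dual ?(ss i) // ij mulr0.
rewrite big_seq big1 // => i is_; rewrite dotZ co_dual ?(ss i) //.
by have [ij|_] := eqVneq i j; [rewrite -ij is_ in jsn | rewrite mulr0].
Qed.

Lemma span_of_coord s x : uniq s -> {subset s <= sigma} -> x \in span_of s ->
  x = \sum_(i <- s) dot x (co i) *: alpha i.
Proof.
move=> us ss xs; have [a xE] := span_of_sum us xs.
rewrite {1}xE; apply: eq_big_seq => i is_.
by rewrite xE dot_co_sum ?ss // is_.
Qed.

Lemma span_of_coord0 s x j : uniq s -> {subset s <= sigma} -> x \in span_of s ->
  j \in sigma -> j \notin s -> dot x (co j) = 0.
Proof.
move=> us ss xs js jsn; have [a ->] := span_of_sum us xs.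
by rewrite dot_co_sum // (negbTE jsn).
Qed.

Lemma mem_span_of_coord s x : uniq s -> {subset s <= sigma} ->
  x \in span_of (enum sigma) ->
  (forall j, j \in sigma -> j \notin s -> dot x (co j) = 0) -> x \in span_of s.
Proof.
move=> us ss xs x0.
rewrite (@span_of_coord (enum sigma) x) ?enum_uniq //; last first.
  by move=> i; rewrite mem_enum.
rewrite big_seq; apply: memv_suml => i; rewrite mem_enum => isg.
have [is_|isn] := boolP (i \in s); first by rewrite memvZ // mem_span_of.
by rewrite x0 // scale0r mem0v.
Qed.

Lemma span_of_behead i s x : uniq (i :: s) -> {subset i :: s <= sigma} ->
  x \in span_of (i :: s) -> dot x (co i) = 0 -> x \in span_of s.
Proof.
move=> us ss xs xi; rewrite (span_of_coord us ss xs) big_cons xi scale0r add0r.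
by rewrite big_seq; apply: memv_suml => j js; rewrite memvZ // mem_span_of.
Qed.

Lemma generic_coord_neq0 d S x j : S \subset sigma -> #|S| = d ->
  x \in span_of (enum S) -> generic_vector d x -> j \in S -> dot x (co j) != 0.
Proof.
move=> Ss cS xS gx jS; apply/eqP => xj.
have := gx [seq alpha i | i <- rem j (enum S)].
have -> : x \in <<[seq alpha i | i <- rem j (enum S)]>>%VS.
  apply: (@span_of_behead j) => //.
  - by rewrite -(perm_uniq (perm_to_rem _)) ?enum_uniq // mem_enum.
  - move=> i; rewrite -(perm_mem (perm_to_rem _)) ?mem_enum //.
    exact: (fintype.subsetP Ss).
  - rewrite (@eq_span_of _ (enum S)) // => i.
    by rewrite -(perm_mem (perm_to_rem _)) ?mem_enum.
rewrite size_map size_rem ?mem_enum // -cardE -cS.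
have S0 : (0 < #|S|)%N by apply/card_gt0P; exists j.
rewrite prednK // => H; suff: false by [].
by apply: H => // _ /mapP[i _ ->]; exact: alpha_partial_sum.
Qed.

(** For [s = i_1, ..., i_d], the contribution to the count of the flag with
    spaces spanned by [i_j, ..., i_d], obtained by successive projections along
    its vectors [kappa] onto the coordinate hyperplanes. *)
Fixpoint walk s x : R :=
  if s is i :: s' then
    let k := kappa_of (span_of s) in
    let t := dot x (co i) / dot k (co i) in
    Num.sg (dot k (co i)) * (0 <= t)%R%:R * walk s' (x - t *: k)
  else 1.

Variable v : 'cV[R]_r.
Hypothesis v_pos : forall i, 0 < dot (alpha i) v.

(** The elements of the arrangement are all positive on [v], hence so is their
    sum [kappa], which excludes that its coordinates are all nonpositive. *)
Lemma kappa_of_pos_coord S : S \subset sigma -> (0 < #|S|)%N ->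
  exists2 i, i \in S & 0 < dot (kappa_of (span_of (enum S))) (co i).
Proof.
move=> Ss /card_gt0P[i0 i0S]; set k := kappa_of _.
have kv : 0 < dot k v.
  rewrite dot_sum (bigD1 i0) /=; last by rewrite mem_span_of ?mem_enum.
  by rewrite ltr_wpDr // sumr_ge0 // => i _; exact: ltW.
have enS : {subset enum S <= sigma} by move=> i; rewrite mem_enum; exact: (fintype.subsetP Ss).
have kE := span_of_coord (enum_uniq S) enS (kappa_of_mem _).
case: (pickP (fun i => (i \in S) && (0 < dot k (co i)))) => [i /andP[iS ki]|no].
  by exists i.
suff: dot k v <= 0 by rewrite leNgt kv.
rewrite {1}/k kE dot_sum big_seq sumr_le0 // => i; rewrite mem_enum => iS.
rewrite dotZ mulr_le0_ge0 ?(ltW (v_pos _)) // leNgt.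
by have := no i; rewrite iS => /= /negbT.
Qed.

(** The geometric content: sending the barycentre of each face [S] of the cone
    of [sigma] to the vector [kappa] of the span of [S] defines a piecewise
    linear map of that cone which preserves the span of every face.  The sum is
    the degree of this map at [x], which is that of the identity.  The
    induction projects [x] along the vector [kappa] of the whole space onto the
    facets, where [sum_orthant_crossings] counts the contributions. *)
Lemma sum_walk d S x : S \subset sigma -> #|S| = d ->
  x \in span_of (enum S) -> generic_vector d x ->
  \sum_(s : d.-tuple 'I_n | uniq s && ([set i in s]%SET == S)) walk s x
  = [forall (i | i \in S), 0 < dot x (co i)]%R%:R.
Proof.
elim: d => [|d IH] in S x *.
  move=> _ /cards0_eq -> _ _; rewrite (big_pred1 [tuple]) /=; last first.
    by move=> s; rewrite (tuple0 s) [RHS]eqxx /=; apply/eqP/setP => i; rewrite !inE.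
  rewrite (_ : [forall (i | i \in finset.set0), 0 < dot x (co i)]%R = true) //.
  by apply/forall_inP => i; rewrite inE.
move=> Ss cS xS gx; rewrite sum_enumerations.
have subS s : {subset s <= S} -> {subset s <= sigma}.
  by move=> sS i /sS; exact: (fintype.subsetP Ss).
set k := kappa_of (span_of (enum S)).
pose t i := dot x (co i) / dot k (co i).
have xk_span i : i \in S -> dot k (co i) != 0 ->
    x - t i *: k \in span_of (enum (S :\ i)%SET).
  move=> iS ki.
  have -> : span_of (enum (S :\ i)%SET) = span_of (rem i (enum S)).
    by apply: eq_span_of => j; rewrite mem_enum mem_rem_uniq ?enum_uniq // !inE mem_enum.
  have eS : span_of (enum S) = span_of (i :: rem i (enum S)).
    apply/eq_span_of/perm_mem/perm_to_rem; by rewrite mem_enum.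
  apply: (@span_of_behead i).
  - by rewrite -(perm_uniq (perm_to_rem _)) ?enum_uniq // mem_enum.
  - apply: subS => j; rewrite -(perm_mem (perm_to_rem _)) ?mem_enum //.
  - by rewrite -eS memvB // memvZ // kappa_of_mem.
  - by rewrite dotB dotZ divfK // subrr.
have cS' i : i \in S -> #|(S :\ i)%SET| = d.
  by move=> iS; move: cS; rewrite (cardsD1 i) iS add1n => -[].
have S's i : (S :\ i)%SET \subset sigma by apply: fintype.subset_trans Ss; exact: subD1set.
rewrite -(@sum_orthant_crossings R _ S (fun i => dot x (co i)) (fun i => dot k (co i))).
- apply: eq_bigr => i iS.
  transitivity (\sum_(s : d.-tuple 'I_n | uniq s && ([set j in s]%SET == (S :\ i)%SET))
      Num.sg (dot k (co i)) * (0 <= t i)%R%:R * walk s (x - t i *: k)).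
    apply: eq_bigr => s /andP[_ /eqP sS] /=.
    suff -> : span_of (i :: s) = span_of (enum S) by [].
    apply: eq_span_of => j; rewrite mem_enum -(finset.setD1K iS) -sS !inE.
    by case: eqP.
  rewrite -big_distrr /=.
  have [->|ki] := eqVneq (dot k (co i)) 0; first by rewrite sgr0 !mul0r.
  rewrite IH ?cS' ?xk_span //; last exact: generic_vector_sub.
  by congr (_ * (_%:R)); congr nat_of_bool; apply: eq_forallb => j; rewrite dotB dotZ.
- by apply: kappa_of_pos_coord => //; rewrite cS.
- by move=> i; exact: generic_coord_neq0 gx.
- move=> i j iS jS ji ki; rewrite -[_ * dot k _]dotZ -dotB.
  apply: (@generic_coord_neq0 d (S :\ i)%SET) => //; first exact: cS'.
  + exact: xk_span.
  + exact: generic_vector_sub.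
  + by rewrite !inE ji.
Qed.

Fixpoint flag_kappas s : seq 'rV[R]_r :=
  if s is i :: s' then kappa_of (span_of s) :: flag_kappas s' else [::].

Fixpoint flag_sign s : R :=
  if s is i :: s' then Num.sg (dot (kappa_of (span_of s)) (co i)) * flag_sign s'
  else 1.

Fixpoint in_cone (ks : seq 'rV[R]_r) x : Prop :=
  if ks is k :: ks' then exists2 t : R, 0 <= t & in_cone ks' (x - t *: k)
  else x = 0.

Lemma in_cone_span s x : in_cone (flag_kappas s) x -> x \in span_of s.
Proof.
elim: s => [|i s IH] in x *; first by move=> ->; exact: mem0v.
move=> /= [t _ /IH xs]; rewrite -(subrK (t *: kappa_of (span_of (i :: s))) x).
apply: memvD; last by rewrite memvZ // kappa_of_mem.
apply/(subvP _ _ xs)/sub_span => _ /mapP[j js ->].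
by apply: map_f; rewrite inE js orbT.
Qed.

(** The projections performed by [walk] compute the coordinates of [x] in the
    basis of the vectors [kappa], one after the other. *)
Lemma walkE s x : uniq s -> {subset s <= sigma} -> x \in span_of s ->
  walk s x = flag_sign s * `[< in_cone (flag_kappas s) x >]%:R.
Proof.
elim: s => [|i s IH] in x *.
  move=> _ _; rewrite /span_of span_nil memv0 => /eqP ->.
  by rewrite /= mul1r; case: asboolP.
move=> us ss xs; rewrite [LHS]/= [flag_sign _]/= [flag_kappas _]/=.
set k := kappa_of _; set t := _ / _.
have [->|ki] := eqVneq (dot k (co i)) 0; first by rewrite sgr0 !mul0r.
have is_ : i \in sigma by apply: ss; rewrite inE eqxx.
have us' : uniq s by case/andP: us.
have ss' : {subset s <= sigma} by move=> j js; apply: ss; rewrite inE js orbT.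
rewrite IH //; last first.
  apply: (span_of_behead us ss); first by rewrite memvB // memvZ // kappa_of_mem.
  by rewrite dotB dotZ divfK // subrr.
rewrite mulrACA; congr (_ * _).
rewrite -natrM mulnb; congr (nat_of_bool _)%:R.
apply/andP/asboolP => [[t0 /asboolP xt]|[u u0 xu]]; first by exists t.
have tu : t = u.
  have := in_cone_span xu => /(span_of_coord0 us' ss') /(_ is_ _).
  case/andP: us => /negbTE isn _; rewrite isn => /(_ isT)/eqP.
  rewrite dotB dotZ subr_eq0 => /eqP xi.
  by rewrite /t xi mulfK.
by split; [rewrite tu | apply/asboolP; rewrite tu].
Qed.

End FlagWalk.

(** * The flags spanned by a basis *)

Section BasisFlags.
Variables (R : realType) (r n : nat) (alpha : 'I_n -> 'rV[R]_r).
Implicit Types (s : r.-tuple 'I_n) (F : flag_type R r).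

(** A dual family provides coordinates indexed by [sigma] itself. *)
Lemma index_basis_dual (sigma : {set 'I_n}) : index_basis alpha sigma ->
  exists co : 'I_n -> 'cV[R]_r, forall i j, i \in sigma -> j \in sigma ->
    dot (alpha i) (co j) = (i == j)%:R.
Proof.
move=> /andP[_ freeX]; pose X := in_tuple (gamma_seq alpha sigma).
pose f i : 'rV[R]_r -> R := if insub (index i (enum sigma)) is Some p
  then coord X p else fun=> 0.
exists (fun i => \col_k f i (delta_mx 0 k)) => i j isg jsg.
have jlt : (index j (enum sigma) < size (gamma_seq alpha sigma))%N.
  by rewrite size_map index_mem mem_enum.
have ilt : (index i (enum sigma) < size (gamma_seq alpha sigma))%N.
  by rewrite size_map index_mem mem_enum.
have fj : f j = coord X (Ordinal jlt).
  by rewrite /f; case: insubP => [p _ pE|]; [congr (coord X _); exact: val_inj | rewrite jlt].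
have -> : dot (alpha i) (\col_k f j (delta_mx 0 k)) = f j (alpha i).
  rewrite /dot mxE fj [in RHS](row_sum_delta (alpha i)) linear_sum.
  by apply: eq_bigr => k _; rewrite mxE linearZ.
have -> : alpha i = X`_(Ordinal ilt).
  by rewrite /= (nth_map i) ?nth_index ?mem_enum // -(size_map alpha).
rewrite fj coord_free // -val_eqE /=; congr (nat_of_bool _)%:R.
apply/eqP/eqP => [|-> //] /(congr1 (nth i (enum sigma))).
by rewrite !nth_index ?mem_enum.
Qed.

Definition enumerates (sigma : {set 'I_n}) (s : seq 'I_n) : bool :=
  uniq s && ([set i in s]%SET == sigma).

(** The orderings are read from the end: removing the first index of [s]
    passes from a space of the flag to the preceding one. *)
Definition flag_of (s : seq 'I_n) : flag_type R r :=
  [ffun j : 'I_r.+1 => span_of alpha (drop (r - j) s)].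

Definition basis_mx s : 'M[R]_r := \matrix_(j < r) alpha (tnth s (rev_ord j)).

Lemma flag_of_lift s (j : 'I_r) :
  flag_of s (lift ord0 j) = span_of alpha (drop (rev_ord j) s).
Proof. by rewrite ffunE. Qed.

Lemma row_kappa_flag_of s (j : 'I_r) :
  row j (kappa alpha (flag_of s))
  = kappa_of alpha (span_of alpha (drop (rev_ord j) s)).
Proof. by rewrite rowK flag_of_lift. Qed.

Lemma mem_drop_tnth d (s : d.-tuple 'I_n) (j : 'I_d) m : uniq s ->
  (tnth s j \in drop m s) = (m <= j)%N.
Proof.
move=> us; have x0 := tnth s j; rewrite (tnth_nth x0).
have [mj|jm] := leqP m j.
  have -> : nth x0 s j = nth x0 (drop m s) (j - m) by rewrite nth_drop subnKC.
  by rewrite mem_nth // size_drop size_tuple ltn_sub2r // (leq_ltn_trans mj).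
apply/negP => jd.
have : nth x0 s j \in take m s.
  by rewrite -(nth_take _ jm) mem_nth // size_take size_tuple; case: ifP.
move=> jt; move: us; rewrite -{1}(cat_take_drop m s) cat_uniq => /and3P[_ /hasP[]].
by exists (nth x0 s j).
Qed.

Lemma flag_kappasE d (s : d.-tuple 'I_n) x :
  in_cone (flag_kappas alpha s) x <->
  exists2 t : 'I_d -> R, (forall j, 0 <= t j) &
    x = \sum_j t j *: kappa_of alpha (span_of alpha (drop j s)).
Proof.
elim: d s x => [|d IH] s x.
  rewrite tuple0 /=; split=> [->|[t _ ->]]; last by rewrite big_ord0.
  by exists (fun=> 0) => //; rewrite big_ord0.
case/tupleP: s => i s /=; split=> [[t t0 /IH[u u0 xE]]|[t t0 ->]].
  exists (fun j => if unlift ord0 j is Some k then u k else t).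
    by move=> j; case: unlift.
  rewrite big_ord_recl unlift_none -[LHS](subrK (t *: kappa_of alpha (span_of alpha (i :: s)))).
  by rewrite xE addrC; congr (_ + _); apply: eq_bigr => j _; rewrite liftK.
exists (t ord0) => //; apply/IH; exists (fun j => t (lift ord0 j)) => //.
by rewrite big_ord_recl /= addrAC subrr add0r.
Qed.

Lemma flag_signE d (s : d.-tuple 'I_n) (co : 'I_n -> 'cV[R]_r) :
  flag_sign alpha co s = \prod_(j < d)
    Num.sg (dot (kappa_of alpha (span_of alpha (drop j s))) (co (tnth s j))).
Proof.
elim: d s => [|d IH] s; first by rewrite tuple0 big_ord0.
case/tupleP: s => i s /=; rewrite big_ord_recl IH /= tnth0; congr (_ * _).
by apply: eq_bigr => j _; rewrite tnthS.
Qed.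

Lemma FLplus_flag_of s x : FL alpha (flag_of s) ->
  FLplus alpha x (flag_of s) <-> in_cone (flag_kappas alpha s) x.
Proof.
move=> FLs; rewrite flag_kappasE; split=> [[_ [t t0 xE]]|[t t0 xE]].
  exists (fun j => t (rev_ord j)) => //.
  rewrite xE (reindex_inj rev_ord_inj) /=; apply: eq_bigr => j _.
  by rewrite row_kappa_flag_of rev_ordK.
split=> //; exists (fun j => t (rev_ord j)) => //.
rewrite xE (reindex_inj rev_ord_inj) /=; apply: eq_bigr => j _.
by rewrite row_kappa_flag_of.
Qed.

(** A space of a flag is determined by the elements of the arrangement that it
    contains. *)
Lemma finite_FL : finite_set (FL alpha).
Proof.
pose h (G : {ffun 'I_r.+1 -> {set 'I_n}}) : flag_type R r :=
  [ffun j => span_of alpha (enum (G j))].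
apply: (@sub_finite_set _ _ (h @` [set: {ffun 'I_r.+1 -> {set 'I_n}}])); last first.
  exact/finite_image/finite_finset.
move=> F [_ _ Fbasis]; exists [ffun j => [set i | alpha i \in F j]%SET] => //.
apply/ffunP => j; rewrite !ffunE; apply/eqP; rewrite eqEsubv; apply/andP; split.
  apply/span_subvP => _ /mapP[i + ->]; by rewrite mem_enum inE.
have [s sF sA] := Fbasis j; rewrite -(span_basis sF); apply/span_subvP => v vs.
have [i vE] := sA v vs; rewrite vE mem_span_of // mem_enum inE -vE.
exact: memv_span.
Qed.

Variables (sigma : {set 'I_n}) (co : 'I_n -> 'cV[R]_r).
Hypothesis sigma_basis : index_basis alpha sigma.
Hypothesis co_dual : forall i j, i \in sigma -> j \in sigma ->
  dot (alpha i) (co j) = (i == j)%:R.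

Lemma card_index_basis : #|sigma| = r.
Proof.
have /andP[/eqP spX /eqP] := sigma_basis.
by rewrite spX size_map -cardE dimvf /dim /= mul1n => <-.
Qed.

Lemma enumerates_perm s : enumerates sigma s -> perm_eq s (enum sigma).
Proof.
move=> /andP[us /eqP sE]; apply: uniq_perm => // [|i]; first exact: enum_uniq.
by rewrite mem_enum -sE inE.
Qed.

Lemma enumerates_sub s : enumerates sigma s -> {subset s <= sigma}.
Proof. by move=> /enumerates_perm/perm_mem sE i; rewrite sE mem_enum. Qed.

Lemma enumerates_free s : enumerates sigma s -> free [seq alpha i | i <- s].
Proof.
move=> /enumerates_perm sE; have /andP[_] := sigma_basis.
by rewrite (perm_free (perm_map alpha sE)).
Qed.

Lemma enumerates_span s : enumerates sigma s -> span_of alpha s = fullv.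
Proof.
move=> /enumerates_perm/perm_mem sE; rewrite (eq_span_of _ sE).
by have /andP[/eqP] := sigma_basis.
Qed.

Lemma drop_free s m : enumerates sigma s -> free [seq alpha i | i <- drop m s].
Proof.
move=> /enumerates_free; rewrite -{1}(cat_take_drop m s) map_cat.
exact: catr_free.
Qed.

Lemma dim_span_drop s m : enumerates sigma s ->
  \dim (span_of alpha (drop m s)) = (r - m)%N.
Proof.
move=> /(drop_free m); rewrite /free => /eqP ->.
by rewrite size_map size_drop size_tuple.
Qed.

Lemma FL_flag_of s : enumerates sigma s -> FL alpha (flag_of s).
Proof.
move=> sE; split=> [j|j k jk|j].
- by rewrite ffunE dim_span_drop // subKn // -ltnS.
- rewrite !ffunE; apply: sub_span => _ /mapP[i id ->]; apply: map_f.
  have kr : (r - j = (r - k) + (k - j))%N by have := ltn_ord k; lia.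
  by rewrite kr addnC -drop_drop in id; exact: mem_drop id.
- exists [seq alpha i | i <- drop (r - j) s].
    by rewrite ffunE /basis_of drop_free // eqxx.
  by move=> _ /mapP[i _ ->]; exists i.
Qed.

Lemma mem_span_drop s (j : 'I_r) m : enumerates sigma s ->
  (alpha (tnth s j) \in span_of alpha (drop m s)) = (m <= j)%N.
Proof.
move=> sE; have us : uniq s by case/andP: sE.
have ss := enumerates_sub sE.
apply/idP/idP => [js|mj]; last by rewrite mem_span_of // mem_drop_tnth.
rewrite -(mem_drop_tnth j m us); apply/negPn/negP => jd.
have jsg : tnth s j \in sigma by apply: ss; exact: mem_tnth.
have ds : {subset drop m s <= sigma} by move=> i /mem_drop/ss.
have := span_of_coord0 co_dual (drop_uniq m us) ds js jsg jd.
by rewrite co_dual // eqxx => /eqP; rewrite oner_eq0.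
Qed.

Lemma flag_of_inj s s' : enumerates sigma s -> enumerates sigma s' ->
  flag_of s = flag_of s' -> s = s'.
Proof.
move=> sE s'E FE; apply/eq_from_tnth => j.
have [u u'] : uniq s /\ uniq s' by split; [case/andP: sE | case/andP: s'E].
have : tnth s j \in s'.
  by rewrite (perm_mem (enumerates_perm s'E)) mem_enum (enumerates_sub sE) ?mem_tnth.
case/tnthP => j' jj'; suff jE : j = j' by rewrite jj' jE.
have step (m : nat) : (m <= r)%N -> (m <= j)%N = (m <= j')%N.
  move=> mr; rewrite -(mem_span_drop j m sE) -(mem_span_drop j' m s'E) -jj'.
  have mlt : (r - m < r.+1)%N by rewrite ltnS leq_subr.
  have /ffunP/(_ (Ordinal mlt)) := FE; rewrite !ffunE /= subKn // => -> //.
apply/val_inj/eqP; rewrite eqn_leq -step ?(ltnW (ltn_ord _)) // leqnn /=.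
by rewrite step ?(ltnW (ltn_ord _)) // leqnn.
Qed.

(** The new elements, one for each step, are distinct, so they exhaust the
    basis; by dimension, the first [j] of them span the [j]-th space. *)
Lemma flag_of_surj F : FL alpha F ->
  (forall j : 'I_r, exists i, [/\ i \in sigma, alpha i \in F (lift ord0 j)
     & alpha i \notin F (widen_ord (leqnSn r) j)]) ->
  exists2 s : r.-tuple 'I_n, enumerates sigma s & F = flag_of s.
Proof.
move=> [Fdim Fsub _] /boolp.choice[t tP].
have tinj : injective t.
  suff lt_neq (j k : 'I_r) : (j < k)%N -> t j != t k.
    move=> j k jk; apply/val_inj/eqP; case: (ltngtP j k) => // /lt_neq.
      by rewrite jk eqxx.
    by rewrite jk eqxx.
  move=> jk; apply/eqP => tjk; have [_ _ /negP[]] := tP k; rewrite -tjk.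
  have [_ + _] := tP j; move: {1 2}(alpha _); apply/subvP; apply: Fsub => /=.
  by rewrite /bump.
pose s := [tuple t (rev_ord j) | j < r].
have us : uniq s.
  by rewrite map_inj_uniq ?enum_uniq // => j k /tinj/rev_ord_inj.
have sE : enumerates sigma s.
  rewrite /enumerates us /= eqEcard; apply/andP; split.
    apply/fintype.subsetP => i; rewrite inE => /mapP[j _ ->].
    by have [] := tP (rev_ord j).
  have -> : #|[set i in s]%SET| = r; last by rewrite card_index_basis.
  by rewrite cardsE; have /card_uniqP -> := us; rewrite size_tuple.
exists s => //; apply/ffunP => j; rewrite ffunE.
apply/eqP; rewrite eq_sym eqEdim Fdim dim_span_drop // subKn -1?ltnS // leqnn andbT.
apply/span_subvP => _ /mapP[i id ->].
have /tnthP[k ik] := mem_drop id.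
move: id; rewrite ik mem_drop_tnth // => jk; rewrite tnth_mktuple.
have [_ + _] := tP (rev_ord k); move: {1 2}(alpha _); apply/subvP; apply: Fsub => /=.
by rewrite /bump leq0n; have := ltn_ord k; lia.
Qed.

Section Signs.
Variables (B : 'M[R]_r) (s : r.-tuple 'I_n).
Hypothesis B_unit : B \in unitmx.
Hypothesis sE : enumerates sigma s.

Let us : uniq s. Proof. by case/andP: sE. Qed.

Lemma basis_mx_unit : basis_mx s \in unitmx.
Proof.
pose D := \matrix_(i, j) co (tnth s (rev_ord j)) i 0 : 'M[R]_r.
have : basis_mx s *m D = 1%:M.
  apply/matrixP => i j; rewrite !mxE.
  transitivity (dot (alpha (tnth s (rev_ord i))) (co (tnth s (rev_ord j)))).
    by rewrite /dot mxE; apply: eq_bigr => k _; rewrite !mxE.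
  rewrite co_dual ?(enumerates_sub sE) ?mem_tnth //; congr (nat_of_bool _)%:R.
  apply/eqP/eqP => [|-> //] /(tuple_uniqP _ us)/rev_ord_inj //.
by case/mulmx1_unit.
Qed.

Definition kappa_coords : 'M[R]_r :=
  \matrix_(j, k) dot (kappa_of alpha (span_of alpha (drop (rev_ord j) s)))
                     (co (tnth s (rev_ord k))).

Lemma kappa_coordsE : kappa alpha (flag_of s) = kappa_coords *m basis_mx s.
Proof.
apply/row_matrixP => j; rewrite row_kappa_flag_of.
have ss := enumerates_sub sE.
set x := kappa_of _ _.
have xs : x \in span_of alpha s by rewrite (enumerates_span sE) memvf.
rewrite [LHS](span_of_coord co_dual us ss xs) big_tuple (reindex_inj rev_ord_inj).
rewrite row_mul mulmx_sum_row; apply: eq_bigr => k _.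
by rewrite rowK !mxE.
Qed.

Lemma kappa_coords_trig : is_trig_mx kappa_coords.
Proof.
apply/is_trig_mxP => j k jk; rewrite mxE.
apply: (span_of_coord0 co_dual (drop_uniq (rev_ord j) us)).
- by move=> i /mem_drop; apply: enumerates_sub.
- exact: kappa_of_mem.
- by apply: (enumerates_sub sE); exact: mem_tnth.
- by rewrite mem_drop_tnth //= -ltnNge; have := ltn_ord k; lia.
Qed.

(** The change of basis from [kappa] to the basis of the flag is triangular,
    so the orientation of [kappa] is that of the ordered basis, corrected by
    the signs of the diagonal coefficients. *)
Lemma nu_flag_of :
  (nu B alpha (flag_of s))%:~R = flag_sign alpha co s * Num.sg (\det (basis_mx s *m B)) :> R.
Proof.
have dB : \det (basis_mx s *m B) != 0.
  by rewrite det_mulmx mulf_neq0 // -unitfE -unitmxE // basis_mx_unit.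
have detE : \det (kappa alpha (flag_of s) *m B)
    = (\prod_j kappa_coords j j) * \det (basis_mx s *m B).
  by rewrite kappa_coordsE -mulmxA det_mulmx det_trig // kappa_coords_trig.
have sgE : Num.sg (\det (kappa alpha (flag_of s) *m B))
    = flag_sign alpha co s * Num.sg (\det (basis_mx s *m B)).
  rewrite detE sgrM; congr (_ * _); rewrite flag_signE (reindex_inj rev_ord_inj) /=.
  rewrite (big_morph Num.sg (@sgrM R) (@sgr1 R)).
  by apply: eq_bigr => j _; rewrite mxE rev_ordK.
rewrite -sgE /nu /proper_flag row_free_unit unitmxE unitfE.
have dB0 : \det B != 0 by rewrite -unitfE -unitmxE.
have [d0|d0] := eqVneq (\det (kappa alpha (flag_of s))) 0.
  by rewrite det_mulmx d0 mul0r sgr0.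
rewrite /=; case: asboolP; rewrite /positively_oriented => dpos.
  by rewrite gtr0_sg.
rewrite ltr0_sg // lt_neqAle det_mulmx mulf_neq0 //= leNgt -det_mulmx.
exact/negP.
Qed.

Lemma vol_basis_mx : vol B (gamma_seq alpha sigma) = `|\det (basis_mx s *m B)|.
Proof.
have sz : size (enum sigma) == r by rewrite -cardE card_index_basis.
have /tuple_permP[p pE] : perm_eq s (Tuple sz) by exact: enumerates_perm.
have sp i : tnth s i = tnth (Tuple sz) (p i).
  by rewrite (_ : s = [tuple tnth (Tuple sz) (p i) | i < r]) ?tnth_mktuple //; exact: val_inj.
rewrite /vol; set A := \matrix_(j < r) _.
have -> : basis_mx s = row_perm (perm rev_ord_inj * p)%g A.
  apply/row_matrixP => j; rewrite rowK; apply/rowP => k; rewrite !mxE permM permE sp.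
  have x0 := tnth (Tuple sz) (p (rev_ord j)).
  rewrite (nth_map x0) ?(tnth_nth x0) //.
  by rewrite (eqP sz) ltn_ord.
rewrite row_permE -mulmxA [in RHS]det_mulmx det_perm normrM normrX normrN1 expr1n mul1r.
by [].
Qed.

End Signs.

End BasisFlags.

(** * Residues along a flag of rational functions *)

Section FlagBasis.
Variables (R : realType) (r : nat) (B : 'M[R]_r).
Implicit Types (F : flag_type R r) (G : 'M[R]_r).

Lemma flag_basis_det F G : B \in unitmx -> flag_basis B F G ->
  \det G * \det B = 1.
Proof.
move=> BU [_ _ _ /(congr1 (fun f => f B))].
by rewrite /wedge /dmu mulVmx // det1 det_mulmx.
Qed.

Lemma flag_basis_unit F G : B \in unitmx -> flag_basis B F G -> G \in unitmx.
Proof.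
move=> BU /(flag_basis_det BU) GB; rewrite unitmxE unitfE; apply/eqP => G0.
by move/eqP: GB; rewrite G0 mul0r eq_sym oner_eq0.
Qed.

Lemma mem_flag F G (j : 'I_r.+1) (a : 'rV[R]_r) : G \in unitmx ->
  flag_basis B F G ->
  (a \in F j) <-> (forall k : 'I_r, (j <= k)%N -> (a *m invmx G) 0 k = 0).
Proof.
move=> GU [_ _ /(_ j)/span_basis FjE _].
pose rows i := row i G; pose co i := col i (invmx G).
have co_dual i k : i \in [set: 'I_r]%SET -> k \in [set: 'I_r]%SET ->
    dot (rows i) (co k) = (i == k)%:R.
  move=> _ _; have := congr1 (fun M : 'M_r => M i k) (mulmxV GU).
  by rewrite !mxE /dot mxE => <-; apply: eq_bigr => l _; rewrite !mxE.
have dotE k : dot a (co k) = (a *m invmx G) 0 k.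
  by rewrite /dot !mxE; apply: eq_bigr => l _; rewrite !mxE.
have enT k : k \in enum 'I_r by rewrite mem_enum.
have aT : a \in span_of rows (enum [set: 'I_r]%SET).
  rewrite -[a](mulmxKV GU) mulmx_sum_row; apply: memv_suml => k _.
  by rewrite memvZ // mem_span_of // mem_enum inE.
have us : uniq (take j (enum 'I_r)) by rewrite take_uniq // enum_uniq.
have mem_take k : (k \in take j (enum 'I_r)) = (k < j)%N.
  by rewrite in_take // index_enum_ord.
have -> : F j = span_of rows (take j (enum 'I_r)).
  by rewrite -FjE /span_of map_take.
have sT : {subset take j (enum 'I_r) <= [set: 'I_r]%SET} by move=> k; rewrite inE.
split=> [aj k jk|a0].
  rewrite -dotE (span_of_coord0 co_dual us sT aj) ?inE //.
  by rewrite mem_take -leqNgt.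
apply: (mem_span_of_coord co_dual us sT aT) => k _.
by rewrite mem_take -leqNgt dotE => /a0.
Qed.

(** Translates the criterion of [iter_residue_no_pole] into one on the flag. *)
Lemma last_nonzero_flag F G (j : 'I_r) (a : 'rV[R]_r) : G \in unitmx ->
  flag_basis B F G ->
  last_nonzero (map_mx (real_complex R) (a *m invmx G)) j ->
  a \in F (lift ord0 j) /\ a \notin F (widen_ord (leqnSn r) j).
Proof.
move=> GU FG [i [/val_inj -> aj ak]]; split.
  apply/(mem_flag _ _ GU FG) => k jk; have /eqP := ak k jk.
  by rewrite mxE fmorph_eq0 => /eqP.
apply/negP => /(mem_flag _ _ GU FG)/(_ j (leqnn _)) a0; move: aj.
by rewrite mxE a0 rmorph0 eqxx.
Qed.

End FlagBasis.

Lemma lin_divr (K : fieldType) (a x y x' y' : K) : y != 0 -> y' != 0 ->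
  a * (x / y) + x' / y' = (a * x * y' + x' * y) / (y * y').
Proof. by move=> y0 y'0; field; rewrite y0 y'0. Qed.

Lemma tofrac_div_inj (D : idomainType) (x y x' y' : D) : y != 0 -> y' != 0 ->
  x%:F / y%:F = x'%:F / y'%:F -> x * y' = x' * y.
Proof.
move=> y0 y'0 /eqP; rewrite eqr_div ?tofrac_eq0 // -!tofracM tofrac_eq.
by move=> /eqP.
Qed.

Lemma scale_cross (K : comNzRingType) (A : comAlgType K) (a b : K)
    (p q d p' q' d' : A) :
  p' * (b *: q) = (a *: q') * d' -> p * q = q' * d ->
  (b *: (p' * d)) * q = (a *: (p * d')) * q.
Proof.
move=> pq2 pq; transitivity (p' * (b *: q) * d).
  by rewrite -!scalerAl -scalerAr -scalerAl mulrAC.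
by rewrite pq2 -!scalerAl mulrAC -pq mulrAC.
Qed.

Lemma div_cross (K : fieldType) (a b x y x' y' : K) : y != 0 -> y' != 0 ->
  b * (x' * y) = a * (x * y') -> b * (x' / y') = a * (x / y).
Proof.
by move=> y0 y'0 xy; apply/eqP; rewrite !mulrA eqr_div // -!mulrA xy.
Qed.

Lemma pow2_scale_eq0 (K : numFieldType) (x : K) d1 d2 m :
  2 ^+ d2 * (x / 2 ^+ m) = 2 ^+ d1 * x -> d2 != (d1 + m)%N -> x = 0.
Proof.
have two0 k : (2 : K) ^+ k != 0 by rewrite expf_neq0 // pnatr_eq0.
move=> xE; have : 2 ^+ d2 * x - 2 ^+ d1 * 2 ^+ m * x = 0.
  by rewrite mulrAC -xE -mulrA divfK // subrr.
rewrite -mulrBl => /eqP; rewrite mulf_eq0 => /orP[|/eqP //].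
by rewrite subr_eq0 -exprD -!natrX eqr_nat eqn_exp2l // => ->.
Qed.

Section RationalFunctionResidue.
Variables (R : realType) (r : nat).
Implicit Types (p q : mpoly r R[i]) (phi psi : {fraction (mpoly r R[i])}).
Implicit Types (v : 'cV[R[i]]_r) (w : 'rV[R[i]]_r) (G : 'M[R]_r).

Local Notation eval_at v := (meval (fun j => fun_of_matrix v j 0)).

Lemma rf_evalE p q v : eval_at v q != 0 ->
  rf_eval (p%:F / q%:F) v = eval_at v p / eval_at v q.
Proof.
move=> qv; rewrite /rf_eval; case: xgetP => [y _ [p' [q' [pq q'v ->]]]|]; last first.
  by move=> /(_ (eval_at v p / eval_at v q)) no; exfalso; apply: no; exists p, q.
have nz s : eval_at v s != 0 -> s != 0.
  by apply: contraNneq => ->; rewrite rmorph0.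
have /(congr1 (eval_at v)) := tofrac_div_inj (nz _ qv) (nz _ q'v) pq.
rewrite !rmorphM => pq'; apply/eqP; rewrite eqr_div //.
by apply/eqP; rewrite pq'.
Qed.

Lemma rf_eval_lin a p q p' q' v : eval_at v q != 0 -> eval_at v q' != 0 ->
  rf_eval ((mpolyC r a)%:F * (p%:F / q%:F) + p'%:F / q'%:F) v
  = a * rf_eval (p%:F / q%:F) v + rf_eval (p'%:F / q'%:F) v.
Proof.
move=> qv qv'.
have nz s : eval_at v s != 0 -> s%:F != 0.
  by rewrite tofrac_eq0; apply: contraNneq => ->; rewrite rmorph0.
have -> : (mpolyC r a)%:F * (p%:F / q%:F) + p'%:F / q'%:F
    = (mpolyC r a * p * q' + p' * q)%:F / (q * q')%:F.
  by rewrite tofracD !tofracM lin_divr ?nz.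
have qqv : eval_at v (q * q') != 0 by rewrite rmorphM mulf_neq0.
by rewrite !rf_evalE // rmorphD !rmorphM /= mevalC lin_divr.
Qed.

Definition point_of G w : 'cV[R[i]]_r :=
  invmx (map_mx (real_complex R) G) *m w^T.

Definition complex_form G (a : 'rV[R]_r) : 'rV[R[i]]_r :=
  map_mx (real_complex R) (a *m invmx G).

Lemma form_appE m (l w : 'rV[R[i]]_m) : form_app l w = (l *m w^T) 0 0.
Proof. by rewrite mxE; apply: eq_bigr => i _; rewrite mxE. Qed.

Lemma eval_linear_form G a w :
  eval_at (point_of G w) (linear_form a) = form_app (complex_form G a) w.
Proof.
rewrite form_appE /complex_form map_mxM map_invmx -mulmxA mxE.
rewrite /linear_form rmorph_sum; apply: eq_bigr => j _.
by rewrite [LHS]mevalZ mevalXU [in RHS]mxE.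
Qed.

Lemma complex_form_neq0 G a : G \in unitmx -> a != 0 -> complex_form G a != 0.
Proof.
move=> GU a0; rewrite map_mx_eq0; apply: contra_neq a0 => aG.
by rewrite -(mulmxKV GU a) aG mul0mx.
Qed.

Lemma eval_poles_in G (Q : 'rV[R[i]]_r -> Prop) p :
  poles_in Q (fun w => eval_at (point_of G w) p).
Proof.
rewrite (_ : (fun w => _) = fun w => \sum_(m <- msupp p)
  mcoeff m p * \prod_i \prod_(j < m i)
     form_app (row i (invmx (map_mx (real_complex R) G))) w); last first.
  apply/funext => w; rewrite mevalE; apply: eq_bigr => m _; congr (_ * _).
  apply: eq_bigr => i _; rewrite prodr_const card_ord; congr (_ ^+ _).
  by rewrite form_appE -row_mul [RHS]mxE.
apply: poles_in_sum => m; apply: poles_in_mul; first exact: poles_in_cst.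
by apply: poles_in_prod => i; apply: poles_in_prod => j; exact: poles_in_form.
Qed.

Variables (n : nat) (alpha : 'I_n -> 'rV[R]_r).
Hypothesis alpha_neq0 : forall i, alpha i != 0.
Implicit Types (k : 'I_n -> nat).

Lemma eval_den G k w : eval_at (point_of G w) (den alpha k)
  = \prod_i form_app (complex_form G (alpha i)) w ^+ k i.
Proof.
rewrite rmorph_prod; apply: eq_bigr => i _.
by rewrite rmorphXn /= eval_linear_form.
Qed.

Lemma eval_den_neq0 G k : G \in unitmx ->
  generically (fun w => eval_at (point_of G w) (den alpha k) != 0).
Proof.
move=> GU; have := @generically_forms _ r 'I_n (fun i => complex_form G (alpha i)).
case=> [i|A A0 AP]; first exact: complex_form_neq0.
exists A => // w /AP wA; rewrite eval_den prodf_seq_neq0.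
by apply/allP => i _; rewrite expf_neq0.
Qed.

Definition den_pole G k (l : 'rV[R[i]]_r) : Prop :=
  exists2 i, k i != 0%N & l = complex_form G (alpha i).

Lemma rf_eval_poles_in G p k : G \in unitmx ->
  exists2 f, poles_in (den_pole G k) f &
    generically (fun w => f w = rf_eval (p%:F / (den alpha k)%:F) (point_of G w)).
Proof.
move=> GU; exists (fun w => eval_at (point_of G w) p *
    \prod_i \prod_(j < k i) (form_app (complex_form G (alpha i)) w)^-1).
  apply: poles_in_mul; first exact: eval_poles_in.
  apply: poles_in_prod => i; apply: poles_in_prod => j; apply: poles_in_inv.
    by exists i => //; rewrite -lt0n (leq_ltn_trans _ (ltn_ord j)).
  exact: complex_form_neq0.
apply: generically_impl (eval_den_neq0 k GU) => w dw.
rewrite rf_evalE // eval_den -prodfV; congr (_ * _); apply: eq_bigr => i _.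
by rewrite prodr_const card_ord exprVn.
Qed.

Lemma CA_is_iter_residue G phi : G \in unitmx -> CA alpha phi ->
  is_iter_residue (fun w => rf_eval phi (point_of G w)) (Res G phi).
Proof.
move=> GU [p [k ->]]; have [f fQ fE] := rf_eval_poles_in p k GU.
have [x fx] := poles_in_iter_residue fQ.
have := is_iter_residue_generic fE fx => /[dup] /iter_residueE.
by rewrite -[iter_residue _]/(Res G _) => ->.
Qed.

Lemma Res_lin G a phi psi : G \in unitmx -> CA alpha phi -> CA alpha psi ->
  Res G ((mpolyC r a)%:F * phi + psi) = a * Res G phi + Res G psi.
Proof.
move=> GU Cphi Cpsi; apply: iter_residueE.
apply: is_iter_residue_generic
  (is_iter_residue_lin a (CA_is_iter_residue GU Cphi) (CA_is_iter_residue GU Cpsi)).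
move: Cphi Cpsi => [p [k ->]] [p' [k' ->]].
have := generically_and (eval_den_neq0 k GU) (eval_den_neq0 k' GU).
by apply: generically_impl => w [kw k'w]; rewrite rf_eval_lin.
Qed.

Lemma Res_no_pole G p k j : G \in unitmx -> (j < r)%N ->
  (forall i, k i != 0%N -> ~ last_nonzero (complex_form G (alpha i)) j) ->
  Res G (p%:F / (den alpha k)%:F) = 0.
Proof.
move=> GU jr kj; have [f fQ fE] := rf_eval_poles_in p k GU.
apply/iter_residueE/(is_iter_residue_generic fE).
apply: (@iter_residue_no_pole _ _ (den_pole G k) _ j) => // _ [i ki ->].
exact: kj.
Qed.

Definition dilate (a : R[i]) p : mpoly r R[i] :=
  comp_mpoly [tuple a *: mpolyX R[i] (mnm1 j) | j < r] p.

Lemma eval_dilate a p v : eval_at v (dilate a p) = eval_at (a *: v) p.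
Proof.
rewrite comp_mpoly_meval; apply: meval_eq => j.
by rewrite tnth_mktuple mevalZ mevalXU mxE.
Qed.

Lemma eval_scale_dilatel a b p q v :
  eval_at v (a *: (dilate b p * q)) = a * (eval_at (b *: v) p * eval_at v q).
Proof. by rewrite mevalZ mevalM eval_dilate. Qed.

Lemma eval_scale_dilater a b p q v :
  eval_at v (a *: (p * dilate b q)) = a * (eval_at v p * eval_at (b *: v) q).
Proof. by rewrite mevalZ mevalM eval_dilate. Qed.

Lemma dilate_homogeneous a d p : homogeneous_poly d p ->
  dilate a p = a ^+ d *: p.
Proof.
move=> /dhomogP hp; rewrite /dilate comp_mpolyEX [in RHS](mpolyE p) scaler_sumr.
apply: eq_big_seq => m /hp md; rewrite comp_mpolyX scalerA mulrC -scalerA.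
congr (_ *: _); rewrite -md /= mdegE mpolyXE_id expr_sum -scaler_prod /=.
by apply: eq_bigr => i _; rewrite tnth_mktuple exprZn.
Qed.

Lemma linear_form_neq0 (a : 'rV[R]_r) : a != 0 -> linear_form a != 0.
Proof.
apply: contra_neq => la; apply/rowP => j; rewrite mxE.
have := congr1 (meval (fun i => (i == j)%:R : R[i])) la.
rewrite rmorph0 /linear_form rmorph_sum (bigD1 j) //= big1 => [|i /negbTE ij].
  by rewrite mevalZ mevalXU eqxx mulr1 addr0 => /eqP; rewrite fmorph_eq0 => /eqP.
by rewrite mevalZ mevalXU ij mulr0.
Qed.

Lemma den_neq0 k : den alpha k != 0.
Proof.
rewrite prodf_seq_neq0; apply/allP => i _.
by rewrite expf_neq0 // linear_form_neq0.
Qed.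

(** Dilating all variables by 2 multiplies a function of degree [d] by
    [2 ^ d], and divides each of the [r] residues by 2. *)
Lemma Res_homogeneous G (d : int) phi : G \in unitmx -> CA alpha phi ->
  homogeneous_ratfun d phi -> d != - r%:Z -> Res G phi = 0.
Proof.
move=> GU Cphi [d1 [d2 [p1 [q1 [hp1 hq1 q10 phiE dE]]]]] dr.
have resphi := CA_is_iter_residue GU Cphi.
have [p [k phipk]] := Cphi.
have two0 : (2 : R[i]) != 0 by rewrite pnatr_eq0.
have key : 2 ^+ d2 *: (dilate 2 p * den alpha k)
    = 2 ^+ d1 *: (p * dilate 2 (den alpha k)).
  have pq : p * q1 = p1 * den alpha k.
    by apply: tofrac_div_inj (den_neq0 k) q10 _; rewrite -phipk.
  have := congr1 (dilate 2) pq; rewrite /dilate !rmorphM /= -!/(dilate 2 _).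
  rewrite (dilate_homogeneous 2 hp1) (dilate_homogeneous 2 hq1) => pq2.
  exact: (mulIf q10 (scale_cross pq2 pq)).
have scale2 v : eval_at v (den alpha k) != 0 -> eval_at (2 *: v) (den alpha k) != 0 ->
    2 ^+ d2 * rf_eval phi (2 *: v) = 2 ^+ d1 * rf_eval phi v.
  move=> dv d2v; rewrite phipk (rf_evalE p dv) (rf_evalE p d2v).
  apply: (div_cross dv d2v); apply: etrans (esym (eval_scale_dilatel _ _ _ _ _)) _.
  exact: etrans (congr1 (eval_at v) key) (eval_scale_dilater _ _ _ _ _).
have c2 : (2 : R[i]) ^+ d2 * (Res G phi / 2 ^+ r) + 0 = 2 ^+ d1 * Res G phi + 0.
  have := is_iter_residue_lin (2 ^+ d2) (is_iter_residue_scale two0 resphi)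
    (is_iter_residue0 _ r).
  have := is_iter_residue_lin (2 ^+ d1) resphi (is_iter_residue0 _ r).
  move=> /iter_residueE <- /iter_residueE <-; apply: eq_iter_residue.
  have dw := eval_den_neq0 k GU.
  apply: generically_impl (generically_and dw (generically_scale two0 dw)) => w [dw1].
  have -> : point_of G (2 *: w) = 2 *: point_of G w.
    by rewrite /point_of linearZ /= scalemxAr.
  by move=> dw2; rewrite scale2.
rewrite !addr0 in c2; apply: (pow2_scale_eq0 c2).
by apply: contraNneq dr => d2E; rewrite dE d2E; apply/eqP; lia.
Qed.

(** In the coordinates of an adapted basis [G], the forms taken in the order of
    the flag have a triangular matrix, whose determinant is that of the ordered
    forms since [G] has determinant 1 in units of the dual lattice. *)
Lemma Res_basis (B : 'M[R]_r) (sigma : {set 'I_n}) co (s : r.-tuple 'I_n) G :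
  B \in unitmx -> index_basis alpha sigma ->
  (forall i j, i \in sigma -> j \in sigma -> dot (alpha i) (co j) = (i == j)%:R) ->
  enumerates sigma s -> flag_basis B (flag_of alpha s) G ->
  Res G (\prod_(i in sigma) linear_form (alpha i))%:F^-1
  = real_complex R (\det (basis_mx alpha s *m B))^-1.
Proof.
move=> BU sb co_dual sE FG.
have GU := flag_basis_unit BU FG.
have detGB := flag_basis_det BU FG.
pose M := basis_mx alpha s *m invmx G.
have MT : is_trig_mx M.
  apply/is_trig_mxP => i j ij.
  have aF : alpha (tnth s (rev_ord i)) \in flag_of alpha s (lift ord0 i).
    rewrite flag_of_lift mem_span_of // mem_drop_tnth //.
    by case/andP: sE.
  have /(mem_flag _ _ GU FG)/(_ j) := aF.
  rewrite /= /bump leq0n add1n => /(_ ij) aj; rewrite -[RHS]aj.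
  have -> : alpha (tnth s (rev_ord i)) = row i (basis_mx alpha s) by rewrite rowK.
  by rewrite -row_mul [RHS]mxE.
have detM : \det M * \det G = \det (basis_mx alpha s).
  by rewrite -det_mulmx mulmxKV.
have M0 : \det M != 0.
  have : \det (basis_mx alpha s) != 0.
    by rewrite -unitfE -unitmxE (basis_mx_unit co_dual sE).
  by rewrite -detM mulf_eq0 => /norP[].
pose MC := map_mx (real_complex R) M.
have MCT : is_trig_mx MC.
  by apply/is_trig_mxP => i j ij; rewrite mxE (is_trig_mxP MT) // rmorph0.
have MC0 i : MC i i != 0.
  rewrite mxE fmorph_eq0; move: M0; rewrite det_trig //.
  by rewrite prodf_seq_neq0 => /allP/(_ i (mem_index_enum _)).
have valE : \prod_i (MC i i)^-1 = real_complex R (\det (basis_mx alpha s *m B))^-1.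
  rewrite prodfV -det_trig // det_map_mx fmorphV; congr (_ _)^-1.
  by rewrite [in RHS]det_mulmx -detM -mulrA detGB mulr1.
rewrite -valE; apply: iter_residueE.
apply: is_iter_residue_generic (iter_residue_triangular MCT MC0).
have prodE (f : 'I_n -> R[i]) : \prod_(i in sigma) f i = \prod_j f (tnth s (rev_ord j)).
  rewrite -big_enum -(perm_big _ (enumerates_perm sE)) big_tuple /=.
  by rewrite (reindex_inj rev_ord_inj).
have rowMC j : row j MC = complex_form G (alpha (tnth s (rev_ord j))).
  by rewrite /MC -map_row /M row_mul rowK.
have := @generically_forms _ r 'I_r (fun j => row j MC).
case=> [j|A A0 AP]; first by rewrite rowMC complex_form_neq0.
exists A => // w /AP wA; set q := \prod_(i in sigma) _.
have qE : meval (fun j => fun_of_matrix (point_of G w) j 0) q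
    = \prod_j form_app (row j MC) w.
  rewrite rmorph_prod /= prodE; apply: eq_bigr => j _.
  by rewrite eval_linear_form rowMC.
rewrite -[q%:F^-1]mul1r -tofrac1 rf_evalE qE; last first.
  by rewrite prodf_seq_neq0; apply/allP => i _; exact: wA.
by rewrite rmorph1 mul1r prodfV.
Qed.

End RationalFunctionResidue.

(** * Chambers and regular vectors *)

Section Chambers.
Variables (R : realType) (r n : nat) (alpha : 'I_n -> 'rV[R]_r).

(** A chamber avoids the boundary of the cone, so its traces on the interior and
    on the closure of the cone coincide.  This trace is both open and closed in
    the chamber, which is connected. *)
Lemma chamber_cone (c : set 'rV[R]_r) (sigma : {set 'I_n}) :
  chamber alpha c -> index_basis alpha sigma ->
  c `<=` cone alpha sigma \/ c `&` cone alpha sigma = set0.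
Proof.
move=> [x xloc ->] sb; set c' := connected_component _ _.
have c'sub : c' `<=` chamber_locus alpha by exact: connected_component_sub.
have c'conn : connected c' by exact: component_connected.
have off y : c' y -> closure (cone alpha sigma) y -> interior (cone alpha sigma) y.
  move=> /c'sub[_ yb] ycl; apply: contrapT => yint; apply: yb.
  by exists sigma.
have intE : c' `&` interior (cone alpha sigma) = c' `&` closure (cone alpha sigma).
  apply/seteqP; split=> y [cy yc]; split=> //; last exact: off.
  exact: (subset_closure (interior_subset yc)).
have [int0|/set0P int1] := eqVneq (c' `&` interior (cone alpha sigma)) set0.
  right; apply/seteqP; split=> // y [cy yc].
  by rewrite -int0 intE; split=> //; exact: subset_closure.
left; have -> : c' = c' `&` interior (cone alpha sigma).
  apply/esym/c'conn => //.
    exists (interior (cone alpha sigma)) => //; exact: open_interior.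
  exists (closure (cone alpha sigma)) => //; exact: closed_closure.
by move=> y [_ /interior_subset].
Qed.

Lemma free_completion (s X : seq 'rV[R]_r) : free s ->
  exists s', [/\ {subset s' <= X}, free (s ++ s')
    & <<s ++ s'>>%VS = <<s ++ X>>%VS].
Proof.
elim: X s => [|x X IH] s fs; first by exists [::]; rewrite cats0.
have [xs|xs] := boolP (x \in <<s>>%VS).
  have [s' [sX fs' E]] := IH s fs; exists s'; split=> //.
    by move=> y /sX; rewrite inE orbC => ->.
  rewrite E !span_cat span_cons addvA; congr (_ + _)%VS.
  by apply/esym/addv_idPl; rewrite -memvE.
have fs1 : free (rcons s x).
  by rewrite -cats1 -(perm_free (permEl (perm_catC [:: x] s))) free_cons xs.
have [s' [sX fs' E]] := IH _ fs1; exists (x :: s'); split.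
- by move=> y; rewrite !inE => /orP[->//|/sX ->]; rewrite orbT.
- by rewrite -cat_rcons.
- by rewrite -!cat_rcons.
Qed.

(** If [xi] were spanned by fewer than [r] partial sums, a free subfamily of
    these could be completed by elements of [sigma] to a basis, and the
    coordinates of [xi] on the added elements would vanish. *)
Lemma regular_generic (xi : 'rV[R]_r) (sigma : {set 'I_n}) :
  index_basis alpha sigma -> regular alpha xi -> generic_vector alpha r xi.
Proof.
move=> sb xireg s sA sr; apply/negP => xis.
have dimV : \dim {:'rV[R]_r} = r by rewrite dimvf /dim /= mul1n.
have [s1 [s1s fs1 E1]] := @free_completion [::] s (nil_free _).
rewrite /= in fs1 E1; rewrite -E1 in xis.
have s1r : (size s1 < r)%N.
  by move: fs1; rewrite /free E1 => /eqP <-; apply: leq_ltn_trans (dim_span s) sr.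
have [s2 [s2s fs2 E2]] := @free_completion s1 (gamma_seq alpha sigma) fs1.
have span2 : <<s1 ++ s2>>%VS = {:'rV[R]_r}%VS.
  apply/eqP; rewrite E2 eqEsubv subvf span_cat /=.
  by have /andP[/eqP <- _] := sb; exact: addvSr.
have sz2 : size (s1 ++ s2) == r.
  by move: fs2; rewrite /free span2 dimV => /eqP <-.
pose rho := Tuple sz2.
have rhob : basis_of {:'rV[R]_r}%VS rho by rewrite /basis_of span2 eqxx fs2.
have rhoA v : v \in (rho : seq _) -> partial_sums alpha v.
  rewrite mem_cat => /orP[/s1s/sA //|/s2s/mapP[i _ ->]]; exact: alpha_partial_sum.
have := xireg rho rhoA rhob (Ordinal s1r); rewrite (coord_span (X := in_tuple s1) xis).
rewrite linear_sum big1 ?eqxx // => i _; rewrite linearZ /=.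
have ilt : (i < r)%N by exact: ltn_trans (ltn_ord i) s1r.
have -> : s1`_i = rho`_(Ordinal ilt) by rewrite /= nth_cat ltn_ord.
rewrite coord_free // -val_eqE /= ltn_eqF ?mulr0 //; exact: ltn_ord.
Qed.

End Chambers.

(** * Uniqueness of the Jeffrey-Kirwan functional *)

Section Uniqueness.
Variables (R : realType) (r n : nat) (B : 'M[R]_r) (alpha : 'I_n -> 'rV[R]_r).
Variable c : set 'rV[R]_r.
Hypothesis c_chamber : chamber alpha c.
Hypothesis alpha_neq0 : forall i, alpha i != 0.
Implicit Types (k : 'I_n -> nat) (p q : mpoly r R[i]).
Implicit Types L : {fraction (mpoly r R[i])} -> R[i].

Lemma CA_frac p k : CA alpha (p%:F / (den alpha k)%:F).
Proof. by exists p, k. Qed.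

Lemma den_mem (sigma : {set 'I_n}) :
  den alpha (fun i => i \in sigma) = \prod_(i in sigma) linear_form (alpha i).
Proof.
by rewrite /den [RHS]big_mkcond; apply: eq_bigr => i _; case: (i \in sigma).
Qed.

Lemma JK_frac_lin L a p q k : is_JK B alpha c L ->
  L ((a *: p + q)%:F / (den alpha k)%:F)
  = a * L (p%:F / (den alpha k)%:F) + L (q%:F / (den alpha k)%:F).
Proof.
move=> LJK; rewrite -(JK_linear LJK); [|exact: CA_frac..].
by congr L; rewrite tofracD mulrDl mulrA -tofracM mul_mpolyC.
Qed.

Lemma linear_form_homogeneous (a : 'rV[R]_r) : homogeneous_poly 1 (linear_form a).
Proof.
apply: rpred_sum => j _; apply: rpredZ.
by rewrite dhomogX /= mdeg1.
Qed.

Lemma den_homogeneous k : homogeneous_poly (\sum_i k i) (den alpha k).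
Proof.
rewrite /den; elim/big_ind2: _ => [||i _]; first exact: dhomog1.
  by move=> d p d' q hp hq; exact: dhomogM.
have := dhomogMn (k i) (linear_form_homogeneous (alpha i)); by rewrite mul1n.
Qed.

Variables L1 L2 : {fraction (mpoly r R[i])} -> R[i].
Hypotheses (JK1 : is_JK B alpha c L1) (JK2 : is_JK B alpha c L2).

Definition agree p k : Prop :=
  L1 (p%:F / (den alpha k)%:F) = L2 (p%:F / (den alpha k)%:F).

Lemma agree0 k : agree 0 k.
Proof.
have L0 L : is_JK B alpha c L -> L (0%:F / (den alpha k)%:F) = 0.
  move=> LJK; have := JK_frac_lin 1 0 0 k LJK.
  by rewrite scale1r addr0 mul1r => /eqP; rewrite -subr_eq subrr eq_sym => /eqP.
by rewrite /agree !L0.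
Qed.

Lemma agree_lin a p q k : agree p k -> agree q k -> agree (a *: p + q) k.
Proof. by move=> pk qk; rewrite /agree !JK_frac_lin // pk qk. Qed.

Lemma agree_sum I (s : seq I) (P : pred I) (a : I -> R[i]) (p : I -> mpoly r R[i]) k :
  (forall i, P i -> agree (p i) k) -> agree (\sum_(i <- s | P i) a i *: p i) k.
Proof.
move=> pk; elim: s => [|i s IH]; first by rewrite big_nil; exact: agree0.
by rewrite big_cons; case: ifP => // /pk ipk; exact: agree_lin.
Qed.

Lemma agree_degree d p k : homogeneous_poly d p -> (d + r)%N != (\sum_i k i)%N ->
  agree p k.
Proof.
move=> hp dk; rewrite /agree.
have hf : homogeneous_ratfun (d%:Z - (\sum_i k i)%:Z) (p%:F / (den alpha k)%:F).
  by exists d, (\sum_i k i)%N, p, (den alpha k); split=> //;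
    [exact: den_homogeneous | exact: den_neq0].
have dr : d%:Z - (\sum_i k i)%:Z != - r%:Z.
  by apply: contraNneq dk => dE; apply/eqP; lia.
by rewrite (JK_degree JK1 (CA_frac p k) hf dr) (JK_degree JK2 (CA_frac p k) hf dr).
Qed.

Definition support_span k : {vspace 'rV[R]_r} :=
  <<[seq alpha i | i <- enum 'I_n & k i != 0%N]>>%VS.

Lemma agree_degenerate p k : support_span k != fullv -> agree p k.
Proof. by move=> kf; rewrite /agree (JK_degenerate JK1) ?(JK_degenerate JK2). Qed.

Lemma agree_basis sigma : index_basis alpha sigma ->
  L1 (\prod_(i in sigma) linear_form (alpha i))%:F^-1
  = L2 (\prod_(i in sigma) linear_form (alpha i))%:F^-1.
Proof.
move=> sb; have [cs|cs] := chamber_cone c_chamber sb.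
  by rewrite (JK_inside JK1) ?(JK_inside JK2).
by rewrite (JK_outside JK1) ?(JK_outside JK2).
Qed.

Lemma agree_one k : support_span k = fullv -> (\sum_i k i)%N = r -> agree 1 k.
Proof.
move=> kf kr; pose sigma := [set i | k i != 0%N]%SET.
have sE : [seq i <- enum 'I_n | k i != 0%N] = enum sigma.
  by rewrite /enum_mem -filter_predI; apply: eq_filter => i; rewrite !inE andbT.
have dimV : \dim {:'rV[R]_r} = r by rewrite dimvf /dim /= mul1n.
have rs : (r <= #|sigma|)%N.
  by rewrite -dimV -kf /support_span sE cardE -(size_map alpha) dim_span.
have sk i : ((i \in sigma) <= k i)%N by rewrite inE; case: (k i).
have cs : (\sum_i (i \in sigma))%N = #|sigma|.
  by rewrite -sum1_card [RHS]big_mkcond; apply: eq_bigr => i _; case: (i \in sigma).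
have k0 : (\sum_i (k i - (i \in sigma)))%N == 0%N.
  by rewrite sumnB // kr cs subn_eq0.
have k1 i : k i = (i \in sigma).
  move: k0; rewrite sum_nat_eq0 => /forall_inP/(_ i isT); rewrite subn_eq0 => ki.
  by apply/eqP; rewrite eqn_leq ki sk.
have sb : index_basis alpha sigma.
  rewrite /index_basis /basis_of /gamma_seq -sE -[<<_>>%VS]/(support_span k) kf eqxx /=.
  rewrite /free -[<<_>>%VS]/(support_span k) kf dimV sE size_map -cardE -cs -kr.
  by apply/eqP/eq_bigr => i _; rewrite k1.
have denE : den alpha k = \prod_(i in sigma) linear_form (alpha i).
  by rewrite -den_mem; apply: eq_bigr => i _; rewrite k1.
by rewrite /agree denE tofrac1 mul1r agree_basis.
Qed.

Lemma linear_form_sum I (s : seq I) (a : I -> R) (b : I -> 'rV[R]_r) :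
  linear_form (\sum_(i <- s) a i *: b i)
  = \sum_(i <- s) real_complex R (a i) *: linear_form (b i).
Proof.
rewrite /linear_form; under [RHS]eq_bigr do rewrite scaler_sumr.
rewrite exchange_big; apply: eq_bigr => j _; rewrite summxE rmorph_sum scaler_suml.
by apply: eq_bigr => i _; rewrite mxE rmorphM scalerA.
Qed.

Lemma linear_form_delta j : linear_form (delta_mx 0 j) = mpolyX R[i] (mnm1 j) :> mpoly r R[i].
Proof.
rewrite /linear_form (bigD1 j) //= mxE !eqxx rmorph1 scale1r big1 ?addr0 //.
by move=> i /negbTE ij; rewrite mxE eqxx ij rmorph0 scale0r.
Qed.

Lemma tofrac_cancel (D : idomainType) (l x y : D) : l != 0 ->
  (l * x)%:F / (l * y)%:F = x%:F / y%:F.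
Proof.
by move=> l0; rewrite !tofracM invfM mulrACA divff ?mul1r // tofrac_eq0.
Qed.

Lemma den_pred k i : k i != 0%N ->
  den alpha k = linear_form (alpha i) * den alpha (fun j => k j - (j == i))%N.
Proof.
move=> ki; rewrite /den (bigD1 i) //= [in RHS](bigD1 i) //= eqxx mulrA -exprS.
rewrite subn1 prednK ?lt0n //; congr (_ * _).
by apply: eq_bigr => j /negbTE ->; rewrite subn0.
Qed.

(** When the forms of the denominator span, a numerator of positive degree is a
    combination of them, and cancelling lowers both degrees.  Only constant
    numerators over a denominator of degree [r] remain; if its forms still span,
    they form a basis. *)
Lemma agree_all p k : agree p k.
Proof.
move kN: (\sum_i k i)%N => N; elim: N p k kN => [|N IH] p k kN.
(* By linearity, the numerator is a monomial.  The degree must then be - r and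
   the denominator must not be degenerate. *)
all: rewrite [p]mpolyE; apply: agree_sum => m _.
all: have hm : homogeneous_poly (mdeg m) (mpolyX R[i] m).
1,3: by rewrite /homogeneous_poly dhomogX /=.
all: have [mN|/(agree_degree hm)//] := eqVneq (mdeg m + r)%N (\sum_i k i)%N.
all: have [kf|/agree_degenerate//] := eqVneq (support_span k) fullv.
all: have [m0|m0] := eqVneq (mdeg m) 0%N.
1,3: by move/eqP: (m0); rewrite mdeg_eq0 => /eqP ->; rewrite mpolyX0;
  apply: agree_one => //; rewrite -mN m0.
  by move: m0; rewrite kN in mN; case: (mdeg m) mN.
have [j mj] : exists j, m j != 0%N.
  apply/existsP; rewrite -negb_forall; apply: contra m0 => /forallP mz.
  by rewrite mdegE big1 // => j _; exact/eqP.
have XE : mpolyX R[i] m = mpolyX R[i] (mnm1 j) * mpolyX R[i] (mnm_sub m (mnm1 j)).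
  by rewrite -mpolyXD addmC submK // lep1mP.
have us : uniq [seq i <- enum 'I_n | k i != 0%N] by rewrite filter_uniq // enum_uniq.
have : delta_mx 0 j \in span_of alpha [seq i <- enum 'I_n | k i != 0%N].
  by rewrite -[span_of _ _]/(support_span k) kf memvf.
case/(span_of_sum us) => a /(congr1 (@linear_form R r)).
rewrite linear_form_delta linear_form_sum XE => ->; rewrite mulr_suml.
under eq_bigr do rewrite -scalerAl.
rewrite big_filter; apply: agree_sum => i ki.
rewrite /agree (den_pred ki) !tofrac_cancel ?linear_form_neq0 //; apply: IH.
rewrite sumnB; last by move=> l _; case: eqP => // ->; rewrite lt0n.
rewrite kN (bigD1 i) //= eqxx big1 ?addn0 ?subn1 // => l /negbTE -> //.
Qed.

Lemma JK_unique phi : CA alpha phi -> L1 phi = L2 phi.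
Proof. by move=> [p [k ->]]; exact: agree_all. Qed.

End Uniqueness.

(** * The sum of iterated residues is the Jeffrey-Kirwan functional *)

Section ResidueSum.
Variables (R : realType) (r n : nat).
Variables (B : 'M[R]_r) (alpha : 'I_n -> 'rV[R]_r).
Hypothesis B_unit : B \in unitmx.
Hypothesis alpha_projective : projective alpha.
Variable gamma : flag_type R r -> 'M[R]_r.
Hypothesis gamma_basis : forall F, FL alpha F -> flag_basis B F (gamma F).
Variable xi : 'rV[R]_r.
Hypothesis xi_regular : regular alpha xi.
Implicit Types (F : flag_type R r) (phi psi : {fraction (mpoly r R[i])}).

Lemma projective_neq0 i : alpha i != 0.
Proof.
have [v v_pos] := alpha_projective.
by apply/eqP => a0; have := v_pos i; rewrite a0 mul0mx mxE ltxx.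
Qed.

Let alpha_neq0 := projective_neq0.

Lemma gamma_unit F : FL alpha F -> gamma F \in unitmx.
Proof. by move=> /gamma_basis/(flag_basis_unit B_unit). Qed.

Definition residue_sum phi : R[i] :=
  \sum_(F \in FLplus alpha xi) (nu B alpha F)%:~R * Res (gamma F) phi.

Lemma finite_FLplus : finite_set (FLplus alpha xi).
Proof. by apply: sub_finite_set (finite_FL alpha) => F []. Qed.

Lemma residue_sum_lin a phi psi : CA alpha phi -> CA alpha psi ->
  residue_sum ((mpolyC r a)%:F * phi + psi) = a * residue_sum phi + residue_sum psi.
Proof.
move=> Cphi Cpsi; rewrite /residue_sum !fsbig_finite; try exact: finite_FLplus.
rewrite big_distrr -big_split; apply: eq_big_seq => F.
rewrite in_fset_set; last exact: finite_FLplus.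
move=> /set_mem[FLF _].
by rewrite /= (Res_lin alpha_neq0 a (gamma_unit FLF) Cphi Cpsi) mulrDr mulrCA.
Qed.

Lemma residue_sum_eq0 phi :
  (forall F, FL alpha F -> Res (gamma F) phi = 0) -> residue_sum phi = 0.
Proof. by move=> phi0; apply: fsbig1 => F [FLF _]; rewrite phi0 // mulr0. Qed.

(** Otherwise, comparing dimensions, the subspace would contain all the spaces
    of the flag in turn. *)
Lemma flag_step_missed F (W : {vspace 'rV[R]_r}) : FL alpha F -> W != fullv ->
  exists j : 'I_r, forall v, v \in W -> v \in F (lift ord0 j) ->
    v \in F (widen_ord (leqnSn r) j).
Proof.
move=> [Fdim Fsub _] Wf; apply: contrapT => /forallNP noj.
suff FW m (mr : (m < r.+1)%N) : (F (Ordinal mr) <= W)%VS.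
  case/eqP: Wf; apply/eqP; rewrite eqEsubv subvf /=.
  apply: subv_trans (FW r (ltnSn r)); suff -> : F (Ordinal (ltnSn r)) = fullv by [].
  by apply/eqP; rewrite eqEdim subvf Fdim dimvf /dim /= mul1n.
elim: m mr => [|m IH] mr.
  have /eqP : \dim (F (Ordinal mr)) = 0%N by rewrite Fdim.
  by rewrite dimv_eq0 => /eqP ->; exact: sub0v.
have mr' : (m < r)%N by [].
have /existsNP[v /not_implyP[vW /not_implyP[vF /negP vF']]] := noj (Ordinal mr').
have EF' : widen_ord (leqnSn r) (Ordinal mr') = Ordinal (ltnW mr) by exact: val_inj.
have EF : lift ord0 (Ordinal mr') = Ordinal mr by exact: val_inj.
rewrite EF' in vF'; rewrite EF in vF.
set V := F (Ordinal (ltnW mr)) in vF'.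
have sub : (V + <[v]> <= F (Ordinal mr))%VS.
  by rewrite subv_add -memvE vF andbT; exact: Fsub.
suff <- : (V + <[v]>)%VS = F (Ordinal mr) by rewrite subv_add IH -memvE.
apply/eqP; rewrite eqEdim sub Fdim /= ltnNge; apply: contra vF' => dimV.
have /eqP -> : V == (V + <[v]>)%VS by rewrite eqEdim addvSl Fdim.
by rewrite memvE addvSr.
Qed.

Lemma residue_sum_degree (d : int) phi : CA alpha phi ->
  homogeneous_ratfun d phi -> d != - r%:Z -> residue_sum phi = 0.
Proof.
move=> Cphi hphi dr; apply: residue_sum_eq0 => F /gamma_unit GU.
exact: (Res_homogeneous alpha_neq0 GU Cphi hphi dr).
Qed.

Lemma Res_missed F (j : 'I_r) p (k : 'I_n -> nat) : FL alpha F ->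
  (forall i, k i != 0%N -> alpha i \in F (lift ord0 j) ->
     alpha i \in F (widen_ord (leqnSn r) j)) ->
  Res (gamma F) (p%:F / (den alpha k)%:F) = 0.
Proof.
move=> FLF kj; have GU := gamma_unit FLF.
apply: (Res_no_pole alpha_neq0 p GU (ltn_ord j)) => i ki.
move=> /(last_nonzero_flag GU (gamma_basis FLF))[iF /negP[]].
exact: kj.
Qed.

Lemma residue_sum_degenerate p (k : 'I_n -> nat) :
  <<[seq alpha i | i <- enum 'I_n & k i != 0%N]>>%VS != {:'rV[R]_r}%VS ->
  residue_sum (p%:F / (den alpha k)%:F) = 0.
Proof.
move=> kf; apply: residue_sum_eq0 => F FLF.
have [j jP] := flag_step_missed FLF kf; apply: (Res_missed (j := j)) => // i ki.
by apply: jP; apply/memv_span/map_f; rewrite mem_filter ki mem_enum.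
Qed.

Lemma sg_div (d : R) : d != 0 -> Num.sg d / d = `|d|^-1.
Proof. by move=> d0; rewrite {2}[d]numEsg invfM mulrA divff ?sgr_eq0 // mul1r. Qed.

(** Only the orderings of [sigma] contribute.  The sign [nu] compares the
    orientation of the vectors [kappa] with the lattice, the residue carries
    the orientation of the ordered basis; their product is the sign used in
    [walk], divided by the volume. *)
Lemma residue_sum_basis sigma : index_basis alpha sigma ->
  residue_sum (\prod_(i in sigma) linear_form (alpha i))%:F^-1
  = if `[< cone alpha sigma xi >]
    then real_complex R (vol B (gamma_seq alpha sigma))^-1 else 0.
Proof.
move=> sb; have [co co_dual] := index_basis_dual sb.
have [v v_pos] := alpha_projective.
have cs : #|sigma| = r by exact: card_index_basis sb.
have gxi := regular_generic sb xi_regular.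
have full : span_of alpha (enum sigma) = fullv by have /andP[/eqP] := sb.
have xs : xi \in span_of alpha (enum sigma) by rewrite full memvf.
set phi := _^-1.
have phiE : phi = 1%:F / (den alpha (fun i => i \in sigma))%:F.
  by rewrite den_mem tofrac1 mul1r.
pose A : pred (r.-tuple 'I_n) := fun s =>
  enumerates sigma s && (flag_of alpha s \in FLplus alpha xi).
(* A flag that is not spanned by an ordering of sigma has a step without a new
   element of sigma, hence residue 0. *)
rewrite /residue_sum (fsbigE [seq flag_of alpha (tval s) | s <- enum A]); first last.
- move=> F [FLF Fxi] Frs; suff -> : Res (gamma F) phi = 0 by rewrite mulr0.
  apply: contrapT => /eqP res0; move/negP: Frs; apply.
  have [s sE FE] : exists2 s : r.-tuple 'I_n, enumerates sigma s & F = flag_of alpha s.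
    apply: (flag_of_surj sb FLF) => j; apply: contrapT => noi.
    case/negP: res0; rewrite phiE (Res_missed (j := j)) // => i.
    case: (boolP (i \in sigma)) => // isg _ iF; apply: contrapT => /negP iF'.
    by apply: noi; exists i.
  rewrite FE; apply: map_f; rewrite mem_enum unfold_in sE /=.
  by apply/mem_set; rewrite -FE.
- by move=> F /= /mapP[s]; rewrite mem_enum => /andP[_ /set_mem sF] ->.
- rewrite map_inj_in_uniq ?enum_uniq // => s s'.
  rewrite !mem_enum => /andP[sE _] /andP[s'E _].
  exact: (flag_of_inj co_dual sE s'E).
rewrite big_map big_enum_cond /=.
(* The sum is extended to all orderings: walk vanishes on those whose flag is
   not in FLplus. *)
transitivity (\sum_(s : r.-tuple 'I_n | enumerates sigma s)
   real_complex R (walk alpha co s xi / vol B (gamma_seq alpha sigma))).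
  rewrite (eq_bigl A) => [|s]; last by rewrite unfold_in /A -andbA andbb.
  rewrite big_mkcondr; apply: eq_bigr => s sE.
  have us : uniq s by case/andP: sE.
  have FLs : FL alpha (flag_of alpha s) by exact: (FL_flag_of sb sE).
  rewrite (walkE co_dual us (enumerates_sub sE)); last first.
    by rewrite (enumerates_span sb sE) memvf.
  rewrite (vol_basis_mx sb B sE).
  have FLxi := FLplus_flag_of xi FLs.
  case: ifPn => [/set_mem/FLxi sxi|/negP sxi]; last first.
    case: asboolP => [/FLxi/mem_set //|_]; by rewrite mulr0 mul0r rmorph0.
  have d0 : \det (basis_mx alpha s *m B) != 0.
    by rewrite -unitfE -unitmxE unitmx_mul (basis_mx_unit co_dual sE).
  case: asboolP => // _; rewrite mulr1 -sg_div // mulrA rmorphM.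
  rewrite -(nu_flag_of sb co_dual B_unit sE) rmorph_int; congr (_ * _).
  exact: (Res_basis alpha_neq0 B_unit sb co_dual sE (gamma_basis FLs)).
rewrite -rmorph_sum -mulr_suml.
rewrite (sum_walk co_dual v_pos _ cs xs gxi) //.
have -> : [forall (i | i \in sigma), 0 < dot xi (co i)]%R = `[< cone alpha sigma xi >].
  apply/forall_inP/asboolP => [xpos|[t t0 xE] i isg].
    exists (fun i => `|dot xi (co i)|); first by move=> i; exact: normr_ge0.
    have enS : {subset enum sigma <= sigma} by move=> i; rewrite mem_enum.
    rewrite [LHS](span_of_coord co_dual (enum_uniq _) enS xs) big_enum.
    by apply: eq_bigr => i /xpos xi0; rewrite gtr0_norm.
  rewrite lt0r (generic_coord_neq0 co_dual _ cs xs gxi) //=.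
  have enS : {subset enum sigma <= sigma} by move=> j; rewrite mem_enum.
  by rewrite xE -big_enum (dot_co_sum co_dual _ (enum_uniq _) enS isg) mem_enum isg.
by case: asboolP => _; rewrite ?mul1r ?mul0r ?rmorph0.
Qed.

Lemma residue_sum_is_JK (c : set 'rV[R]_r) : c xi -> is_JK B alpha c residue_sum.
Proof.
move=> cxi; split.
- exact: residue_sum_lin.
- move=> sigma sb ccone; rewrite residue_sum_basis //.
  by case: asboolP => // /(_ (ccone _ cxi)).
- move=> sigma sb cout; rewrite residue_sum_basis //.
  case: asboolP => // xcone.
  by have : (c `&` cone alpha sigma) xi by []; rewrite cout.
- exact: residue_sum_degree.
- exact: residue_sum_degenerate.
Qed.

End ResidueSum.

Theorem theorem2p6 (R : realType) (r n : nat)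
  (B : 'M[R]_r) (B_unit : B \in unitmx)
  (alpha : 'I_n -> 'rV[R]_r)
  (alpha_lattice : forall i, dual_lattice B (alpha i))
  (alpha_generates : generates_dual_lattice alpha B)
  (alpha_projective : projective alpha)
  (gamma : flag_type R r -> 'M[R]_r)
  (gamma_basis : forall F, FL alpha F -> flag_basis B F (gamma F))
  (c : set 'rV[R]_r) (c_chamber : chamber alpha c)
  (xi : 'rV[R]_r) (xi_in_c : c xi) (xi_regular : regular alpha xi)
  (phi : {fraction (mpoly r R[i])}) (phi_CA : CA alpha phi) :
  JK B alpha c phi
    = \sum_(F \in FLplus alpha xi) (nu B alpha F)%:~R * Res (gamma F) phi.
Proof.
have sumJK := residue_sum_is_JK B_unit alpha_projective gamma_basis xi_regular xi_in_c.
apply: (JK_unique c_chamber (projective_neq0 alpha_projective) _ sumJK phi_CA).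
exact: (@xgetPex _ _ [set L | is_JK B alpha c L] (ex_intro _ _ sumJK)).
Qed.
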